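(* Let $R$ be a commutative Noetherian ring, let $n>m\ge 1$, and let $M$ be a finitely generated $m$-torsionless $R$-module having a well-defined rank. Let $$0\to F_n\xrightarrow{f_n}F_{n-1}\to\cdots\to F_{m+1}\xrightarrow{f_{m+1}}F_m\xrightarrow{g}M\to 0$$ be an exact sequence of finitely generated projective $R$-modules with $F_m$ free, and let $r=\operatorname{rank}(\operatorname{Im} f_{m+1})$. Then there exist homomorphisms $c:F_m\to R^{r+m}$, $f_m:R^{r+m}\to R^{2m-1}$ and $f_j:R^{2j+1}\to R^{2j-1}$ for $j=1,\dots,m-1$ such that, with $f'_{m+1}=c\circ f_{m+1}$, the complex $$0\to F_n\xrightarrow{f_n}F_{n-1}\to\cdots\to F_{m+2}\xrightarrow{f_{m+2}}F_{m+1}\xrightarrow{f'_{m+1}}R^{r+m}\xrightarrow{f_m}R^{2m-1}\xrightarrow{f_{m-1}}R^{2m-3}\to\cdots\to R^3\xrightarrow{f_1}R$$ is exact at every term other than the final $R$ (in particular, for $m\ge 2$ it is a projective resolution of an ideal of $R$ generated by three elements, namely $\operatorname{Im} f_1$).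
   Context: All modules are finitely generated. A module $N$ has well-defined rank $r$ if $N\otimes_R Q(R)$ is free of rank $r$ over the total quotient ring $Q(R)$ (ranks exist for the third module of a short exact sequence if they exist for two of them). $m$-torsionless: for a free presentation $F_1\xrightarrow{\varphi}F_0\to M\to0$ with $D(M)=\operatorname{Coker}(\varphi^* )$, $M$ is $m$-torsionless iff $\operatorname{Ext}^i_R(D(M),R)=0$ for $i=1,\dots,m$; when $\operatorname{pd}M<\infty$ this is equivalent to $\operatorname{depth}(M_{\mathfrak p})\ge\min(m,\operatorname{depth}R_{\mathfrak p})$ for all primes $\mathfrak p$, and to $M$ being an $m$-th syzygy module. *)

(* Defs.v *)
From HB Require Import structures.
From mathcomp Require Import all_boot all_order all_algebra.
Set Implicit Arguments. Unset Strict Implicit. Unset Printing Implicit Defensive.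
Import Order.TTheory GRing.Theory Num.Theory.
Local Open Scope ring_scope.

(* Conventions: modules are lmodType R over a commutative (nonzero) ring R;
   the free module R^k is the row-vector space 'rV[R]_k, and a homomorphism
   R^a -> R^b is right multiplication v |-> v *m A by a matrix A : 'M_(a,b).
   Hom(R^k, R) is identified with 'rV_k, so the dual of v |-> v *m A
   is w |-> w *m A^T. *)

Definition exact_at (A B : Type) (C : zmodType) (u : A -> B) (v : B -> C) :=
  forall b : B, v b = 0 <-> exists a : A, b = u a.

Definition is_ideal (R : comNzRingType) (I : R -> Prop) :=
  [/\ I 0, (forall x y, I x -> I y -> I (x + y)) & (forall a x, I x -> I (a * x))].

Definition noetherian (R : comNzRingType) :=
  forall I : R -> Prop, is_ideal I ->
    exists (k : nat) (x : 'I_k -> R),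
      forall y, I y <-> exists a : 'I_k -> R, y = \sum_i a i * x i.

Definition fg_module (R : comNzRingType) (V : lmodType R) :=
  exists (k : nat) (p : {linear 'rV[R]_k -> V}), forall v, exists w, p w = v.

Definition fg_projective (R : comNzRingType) (V : lmodType R) :=
  exists (k : nat) (i : {linear V -> 'rV[R]_k}) (p : {linear 'rV[R]_k -> V}),
    cancel i p.

Definition fg_free (R : comNzRingType) (V : lmodType R) :=
  exists (k : nat) (i : {linear V -> 'rV[R]_k}) (p : {linear 'rV[R]_k -> V}),
    cancel i p /\ cancel p i.

Definition nzd (R : comNzRingType) (s : R) := forall a : R, s * a = 0 -> a = 0.

(* The submodule P of V has well-defined rank r: P (x) Q(R) = S^-1 P is free of
   rank r over Q(R) = S^-1 R.  Unfolded: there are x_1..x_r in P whose images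
   x_i/1 form an S^-1 R-basis of S^-1 P (any basis can be rescaled by units
   to have denominators 1):
   - spanning: every y in P satisfies s y = sum a_i x_i for some s in S;
   - independence: if sum a_i x_i is S-torsion then all a_i = 0. *)
Definition has_rank_in (R : comNzRingType) (V : lmodType R) (P : V -> Prop) (r : nat) :=
  exists x : 'I_r -> V,
    [/\ forall i, P (x i),
        forall y, P y -> exists s : R, nzd s /\
            exists a : 'I_r -> R, s *: y = \sum_i a i *: x i
      & forall a : 'I_r -> R,
          (exists t : R, nzd t /\ t *: (\sum_i a i *: x i) = 0) -> forall i, a i = 0].

Definition has_rank (R : comNzRingType) (V : lmodType R) (r : nat) :=
  has_rank_in (fun _ : V => True) r.

(* m-torsionless.  A free presentation  F_1 = R^(s 0) --phi--> F_0 = R^(s 1) --p--> M --> 0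
   with phi := (d 0)^T.  Then phi^* : Hom(F_0,R) -> Hom(F_1,R) is w |-> w *m d 0,
   so D(M) = Coker(phi^* ) is presented by d 0 : G_1 = R^(s 1) -> G_0 = R^(s 0).
   The d i : G_(i+1) = R^(s i.+1) -> G_i = R^(s i) extend this to a free resolution
   of D(M) up to G_(m+1) (exact at G_1..G_m), and Ext^i_R(D(M),R) = 0 for
   i = 1..m means the dual complex Hom(G_.,R) is exact at Hom(G_i,R), i = 1..m.
   (Ext does not depend on the choice of resolution or of the presentation.) *)
Definition m_torsionless (R : comNzRingType) (M : lmodType R) (m : nat) :=
  exists (s : nat -> nat) (d : forall i : nat, 'M[R]_(s i.+1, s i))
         (p : {linear 'rV[R]_(s 1) -> M}),
    [/\ (forall y : M, exists w, p w = y),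
        exact_at (fun v : 'rV[R]_(s 0) => v *m (d 0)^T) p,
        (forall i, (i < m)%N ->
           exact_at (fun v : 'rV[R]_(s i.+2) => v *m d i.+1)
                    (fun v : 'rV[R]_(s i.+1) => v *m d i))
      & (forall i, (i < m)%N ->
           exact_at (fun w : 'rV[R]_(s i) => w *m (d i)^T)
                    (fun w : 'rV[R]_(s i.+1) => w *m (d i.+1)^T))].

(* Main.v *)
Require Import Defs.
From Stdlib Require List.
From HB Require Import structures.
From mathcomp Require Import all_boot all_order all_algebra.
From mathcomp Require Import boolp ring zify.
Set Implicit Arguments. Unset Strict Implicit. Unset Printing Implicit Defensive.
Import GRing.Theory.
Local Open Scope ring_scope.

(* The proof follows Bruns. Call a prime critical for m if it is associated to a
   regular sequence of length at most m; a finitely generated ideal has grade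
   greater than m iff it lies in no such prime. Reducing the given resolution
   modulo regular sequences shows that M is free at the critical primes for m.
   If the rank of M exceeds m, basic element theory then provides x in F_m with
   a coordinate 1 whose image in M is part of a basis at all critical primes;
   since its order ideal O has grade greater than m, Ext^i(R/O, R) vanishes for
   i <= m, and M/Rx is again m-torsionless. Iterating, F_m is cut down to
   R^(r+m) and M to a module of rank m. It embeds into a free module with
   (m-1)-torsionless cokernel, to which the same reduction applies with m-1 in
   place of m, and so on down to R. (A free summand is added to M beforehand, in
   case its rank is less than m.) *)

(** * Residue fields *)

(** The odd numbers arise because the rank m module left by a reduction becomes the relation module
    of the next cokernel. The reduction for m-1 therefore stops at m + (m-1) = 2m-1 generators, the
    following one at (m-1) + (m-2) = 2m-3, and so on. The coordinate 1 of x makes F_m/Rx free, not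
    merely projective. Nothing is localized. Freeness at p is a matrix identity with a multiplier
    outside p, ranks are computed over the residue field, and the generic ranks enter through
    vanishing minors. Depth is replaced by exactness modulo regular sequences taken in R itself; at
    an associated prime of such a sequence, splittings propagate along the exact complex, which
    takes the place of the Auslander-Buchsbaum formula. *)

Definition prime_id (R : comNzRingType) (p : R -> Prop) :=
  [/\ is_ideal p, ~ p 1 & forall a b, p (a * b) -> p a \/ p b].

(** The second clause makes [K] the fraction field of R/p, so denominators of matrices over [K] can
    be cleared. *)
Definition residue (R : comNzRingType) (p : R -> Prop) (K : fieldType)
    (phi : {rmorphism R -> K}) :=
  (forall x, phi x = 0 <-> p x) /\
  (forall z : K, exists a b, phi b != 0 /\ z = phi a / phi b).

Section FractionQuotient.
Local Open Scope quotient_scope.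
Lemma fraction_quotient (D : idomainType) (z : {fraction D}) :
  exists a b : D, FracField.tofrac b != 0 /\
    z = FracField.tofrac a / FracField.tofrac b.
Proof.
elim/quotW: z => x; exists (x : ratio _).1, (x : ratio _).2.
have x20 : (FracField.tofrac x.2 != 0 :> {fraction D}).
  by rewrite tofrac_eq0 denom_ratioP.
split=> //; apply: (mulIf x20); rewrite divfK //.
rewrite /FracField.tofrac; unlock; rewrite -[LHS]FracField.pi_mul.
apply/eqmodP; rewrite /= FracField.equivfE /FracField.mulf /=.
by rewrite !numden_Ratio ?mulf_neq0 ?oner_neq0 ?mulr1 ?denom_ratioP // mulrC.
Qed.

End FractionQuotient.

Section DomainFractions.
Variable D : comNzRingType.
Hypothesis intD : forall x y : D, x * y = 0 -> (x == 0) || (y == 0).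

(** Fraction fields are taken over an [idomainType], which carries a unit predicate and an inverse;
    this alias of [D] receives both by classical choice. *)
Definition unit_dom : Type := D.
HB.instance Definition _ := GRing.ComNzRing.on unit_dom.

Definition dom_unit : pred unit_dom := fun x => `[< exists y, y * x = 1 >].
Definition dom_inv (x : unit_dom) : unit_dom :=
  if pselect (exists y, y * x = 1) is left e then projT1 (cid e) else x.

Lemma dom_mulVx : {in dom_unit, left_inverse 1 dom_inv *%R}.
Proof.
move=> x /asboolP xU; rewrite /dom_inv; case: pselect => // e.
by case: (cid e).
Qed.

Lemma dom_unitP (x y : unit_dom) : y * x = 1 -> dom_unit x.
Proof. by move=> xy; apply/asboolP; exists y. Qed.

Lemma dom_inv_out : {in [predC dom_unit], dom_inv =1 id}.
Proof.
by move=> x /asboolP xU; rewrite /dom_inv; case: pselect.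
Qed.

HB.instance Definition _ :=
  GRing.ComNzRing_hasMulInverse.Build unit_dom dom_mulVx dom_unitP dom_inv_out.
HB.instance Definition _ :=
  GRing.ComUnitRing_isIntegral.Build unit_dom intD.

Lemma domain_fractions : exists (K : fieldType) (phi : {rmorphism D -> K}),
  (forall x, phi x = 0 <-> x = 0) /\
  (forall z : K, exists a b, phi b != 0 /\ z = phi a / phi b).
Proof.
pose phi : {rmorphism unit_dom -> {fraction unit_dom}} :=
  @FracField.tofrac unit_dom.
exists {fraction unit_dom}, phi; split=> [x|z].
  by split=> [/eqP|->]; rewrite ?(rmorph0 phi) // tofrac_eq0 => /eqP.
by have [a [b [b0 ->]]] := fraction_quotient z; exists a, b.
Qed.
End DomainFractions.

Section Residue.
Variables (R : comNzRingType) (p : R -> Prop).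
Hypothesis pP : prime_id p.
Local Open Scope quotient_scope.

Definition idpred : {pred R} := fun x => `[< p x >].

Lemma idpredP x : reflect (p x) (x \in idpred).
Proof. exact: asboolP. Qed.

Lemma idpred_closed : idealr_closed idpred.
Proof.
have [[p0 pD pM] p1 _] := pP; split; first exact/idpredP.
  by apply/negP => /idpredP.
by move=> a u v /idpredP pu /idpredP pv; apply/idpredP/pD => //; apply: pM.
Qed.

Lemma idpred_prime : prime_idealr_closed idpred.
Proof.
have [_ _ pr] := pP; move=> u v /idpredP /pr[] h; apply/orP; [left|right];
  exact/idpredP.
Qed.

HB.instance Definition _ := isIdealr.Build R idpred idpred_closed.
HB.instance Definition _ := isPrimeIdealrClosed.Build R idpred idpred_prime.

Lemma residue_field : exists (K : fieldType) (phi : {rmorphism R -> K}),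
  residue p phi.
Proof.
have [K [phi [phi0 phiF]]] :=
  domain_fractions (@Quotient.rquot_IdomainAxiom R (idpred : prime_idealr R)).
exists K, (phi \o \pi_({ideal_quot (idpred : prime_idealr R)}))%FUN; split.
  move=> x; rewrite /= phi0.
  have -> : (\pi_({ideal_quot (idpred : prime_idealr R)}) x = 0) <->
    (x \in idpred).
    by split=> [/eqP|xp]; [|apply/eqP]; rewrite piE Quotient.equivE subr0.
  by split=> /idpredP.
move=> z; have [a [b [b0 ->]]] := phiF z.
by exists (repr a), (repr b); rewrite /= !reprK.
Qed.
End Residue.

(** * Ideals and prime avoidance *)

Section Ideals.
Variable R : comNzRingType.
Implicit Types (I J N p : R -> Prop) (a b c u x y : R).

Definition colon N u c := N (c * u).
Definition nzd_mod N b := forall a, N (b * a) -> N a.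
Definition adjoin N b x := exists a, N (x - b * a).

Lemma ideal0 I : is_ideal I -> I 0. Proof. by case. Qed.

Lemma idealD I x y : is_ideal I -> I x -> I y -> I (x + y).
Proof. by case=> _ h _; apply: h. Qed.

Lemma idealM I a x : is_ideal I -> I x -> I (a * x).
Proof. by case=> _ _; apply. Qed.

Lemma idealMl I a x : is_ideal I -> I x -> I (x * a).
Proof. by rewrite mulrC; apply: idealM. Qed.

Lemma idealN I x : is_ideal I -> I x -> I (- x).
Proof. by rewrite -mulN1r; apply: idealM. Qed.

Lemma idealB I x y : is_ideal I -> I x -> I y -> I (x - y).
Proof. by move=> iI Ix Iy; apply: idealD => //; apply: idealN. Qed.

Lemma ideal_sum I (T : Type) (r : seq T) (P : pred T) (F : T -> R) :
  is_ideal I -> (forall i, P i -> I (F i)) -> I (\sum_(i <- r | P i) F i).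
Proof.
move=> iI IF; elim/big_ind: _ => //; first exact: ideal0.
by move=> x y; apply: idealD.
Qed.

Lemma is_ideal0 : is_ideal (fun x : R => x = 0).
Proof.
by split=> [|x y -> ->|a x ->]; rewrite ?addr0 ?mulr0.
Qed.

Lemma is_ideal_colon N u : is_ideal N -> is_ideal (colon N u).
Proof.
move=> iN; split=> [|x y|a x]; rewrite /colon ?mul0r ?mulrDl -?mulrA.
- exact: ideal0.
- exact: idealD.
- exact: idealM.
Qed.

Lemma is_ideal_adjoin N b : is_ideal N -> is_ideal (adjoin N b).
Proof.
move=> iN; split=> [|x y [c Nx] [d Ny]|a x [c Nx]].
- by exists 0; rewrite mulr0 subr0; apply: ideal0.
- exists (c + d); rewrite mulrDr opprD addrACA; exact: idealD.
- by exists (a * c); rewrite mulrCA -mulrBr; apply: idealM.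
Qed.

Lemma adjoin_sub N b x : N x -> adjoin N b x.
Proof. by exists 0; rewrite mulr0 subr0. Qed.

Lemma adjoin_gen N b : is_ideal N -> adjoin N b b.
Proof. by exists 1; rewrite mulr1 subrr; apply: ideal0. Qed.

Hypothesis noethR : noetherian R.

(** Without a maximal member, choice yields a strictly increasing chain, while the finitely many
    generators of its union already lie in one member. *)
Lemma ideal_maximal (F : (R -> Prop) -> Prop) :
  (exists I, F I) -> (forall I, F I -> is_ideal I) ->
  exists I, F I /\ forall J, F J -> (forall x, I x -> J x) ->
    forall x, J x -> I x.
Proof.
move=> [I0 FI0] Fid; apply: contrapT => noMax.
have next (Z : {Z | F Z}) : {Y : {Y | F Y} |
    (forall x, sval Z x -> sval Y x) /\ exists x, sval Y x /\ ~ sval Z x}.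
  apply: cid; apply: contrapT => noJ; apply: noMax; exists (sval Z).
  split=> [|J FJ IJ x Jx]; first exact: svalP.
  by apply: contrapT => nIx; apply: noJ; exists (exist _ J FJ); split; last by exists x.
pose ch n := iter n (fun Z => sval (next Z)) (exist _ I0 FI0).
have chS n x : sval (ch n) x -> sval (ch n.+1) x by apply: (svalP (next _)).1.
have chle n m x : (n <= m)%N -> sval (ch n) x -> sval (ch m) x.
  by move=> /subnK <-; elim: (m - n)%N => // k IHk /IHk; apply: chS.
have iC n : is_ideal (sval (ch n)) := Fid _ (svalP _).
have iU : is_ideal (fun x => exists n, sval (ch n) x).
  split=> [|x y [n hx] [m hy]|a x [n hx]].
  - by exists 0%N; apply: ideal0.
  - exists (maxn n m); apply: idealD => //.
      by apply: chle hx; apply: leq_maxl.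
    by apply: chle hy; apply: leq_maxr.
  - by exists n; apply: idealM.
have [k [g gP]] := noethR iU.
have gU i : exists n, sval (ch n) (g i).
  apply/gP; exists (fun j => (j == i)%:R).
  rewrite (bigD1 i) //= eqxx mul1r big1 ?addr0 // => j /negPf->.
  by rewrite mul0r.
have [n nP] := choice gU.
pose m := (\max_i n i)%N.
have [x [xm1 xm]] := (svalP (next (ch m))).2.
apply: xm; have /gP[a ->] : exists n, sval (ch n) x by exists m.+1.
apply: ideal_sum => // i _; apply: idealM => //; apply: chle (nP i).
exact: leq_bigmax.
Qed.

End Ideals.

Section Primes.
Variable R : comNzRingType.
Implicit Types (I J N p : R -> Prop) (a b c u x y : R).

Lemma prime_notM p a b : prime_id p -> ~ p a -> ~ p b -> ~ p (a * b).
Proof. by case=> _ _ pr na nb /pr[]. Qed.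

(* Prime avoidance in the form of a moving argument: the primes are treated in
   such an order that none contains an earlier one, and the correction made
   for one prime is multiplied by an element of all the earlier ones. *)
Lemma prime_moving (V : lmodType R) (D : V -> Prop)
    (Good : (R -> Prop) -> V -> Prop) (L : seq (R -> Prop)) :
  D 0 -> (forall s v w, D v -> D w -> D (v + s *: w)) ->
  (forall p, List.In p L -> prime_id p) ->
  (forall p s v w, List.In p L -> p s -> Good p v -> Good p (v + s *: w)) ->
  (forall p v, List.In p L -> D v -> ~ Good p v ->
     exists2 w, D w & forall s, ~ p s -> Good p (v + s *: w)) ->
  exists2 v, D v & forall p, List.In p L -> Good p v.
Proof.
move=> D0 DD; have [n] := ubnP (size L); elim: n L => // n IHn L szL Lp inv dir.
case: L => [|p0 L0] in szL Lp inv dir *; first by exists 0.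
pose le p q := forall x : R, p x -> q x.
(* A prime minimal for inclusion is treated last: each prime of [L'] has an element outside [p], and
   the product of these is the multiplier [s]. *)
have [p [pL pmin]] : exists p, List.In p (p0 :: L0) /\
    forall q, List.In q (p0 :: L0) -> le q p -> le p q.
  elim: (L0) (p0) => [|q L1 IH] p1.
    by exists p1; split=> [|q [<-|[]]]; first left.
  have [y [yL ymin]] := IH p1; case: (pselect (le q y)) => qy.
    exists q; split; first by right; left.
    move=> z [<-|[<-|zL]] zq //; [|move=> x qx]; last first.
      by apply: (ymin z); [right | move=> w /zq/qy | apply: qy].
    by move=> x qx; apply: (ymin p1); [left | move=> w /zq/qy | apply: qy].
  exists y; split; first by case: yL; [left | right; right].
  by move=> z [<-|[<-//|zL]]; apply: ymin; [left|right].
pose L' := [seq q <- p0 :: L0 | ~~ `[< le q p >]].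
have L'L q : List.In q L' -> List.In q (p0 :: L0) /\ ~ le q p.
  rewrite /L'; elim: (p0 :: L0) => //= r L1 IH.
  case: asboolP => /= rp; first by move=> /IH[]; split; first right.
  by move=> [<-|/IH[]]; [split; first left | split; first right].
have LL' q : List.In q (p0 :: L0) -> List.In q L' \/ q = p.
  move=> qL; case: (pselect (le q p)) => qp.
    right; apply/funext => x; apply/propext; split; first exact: qp.
    exact: pmin.
  left; move: qL; rewrite /L'; elim: (p0 :: L0) => //= r L1 IH.
  case: asboolP => /= rp; first by move=> [rq|/IH//]; case: qp; rewrite -rq.
  by move=> [rq|/IH]; [left|right].
have szL' : (size L' < n)%N.
  rewrite ltnS in szL; apply: leq_trans szL; rewrite size_filter.
  have : has (fun q => `[< le q p >]) (p0 :: L0).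
    elim: (p0 :: L0) pL => //= r L1 IH [->|/IH->]; last by rewrite orbT.
    by apply/orP; left; apply/asboolP.
  rewrite has_count -(count_predC (fun q => `[< le q p >]) (p0 :: L0)).
  by move=> h; rewrite -[X in (X < _)%N]add0n ltn_add2r.
have [v Dv vG] : exists2 v, D v & forall q, List.In q L' -> Good q v.
  apply: IHn => // q; first by move=> /L'L[/Lp].
    by move=> s v w /L'L[qL _]; apply: inv.
  by move=> v /L'L[qL _]; apply: dir.
have [s [sp sL']] : exists s, ~ p s /\ forall q, List.In q L' -> q s.
  elim: L' L'L {LL' szL' vG} => [_|q L1 IH qL].
    by exists 1; split=> //; case: (Lp p pL).
  have [s [sp sL]] : exists s, ~ p s /\ forall q, List.In q L1 -> q s.
    by apply: IH => r rL; apply: qL; right.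
  have [qL0 /existsNP[t /not_implyP[qt pt]]] := qL q (or_introl erefl).
  exists (s * t); split; first by apply: prime_notM => //; apply: Lp.
  move=> r [<-|rL]; first by apply: idealM => //; case: (Lp q qL0).
  apply: idealMl; last exact: sL.
  by have [|rL0 _] := qL r; [right | case: (Lp r rL0)].
case: (pselect (Good p v)) => [Gp|nGp].
  by exists v => // q /LL'[/vG//|->].
have [w Dw wG] := dir p v pL Dv nGp.
exists (v + s *: w); first exact: DD.
move=> q /LL'[qL'|->]; last exact: wG.
by apply: inv; [case: (L'L q qL') | apply: sL' | apply: vG].
Qed.

Lemma prime_avoidance I (L : seq (R -> Prop)) :
  is_ideal I -> (forall p, List.In p L -> prime_id p) ->
  (forall p, List.In p L -> exists c, I c /\ ~ p c) ->
  exists b, I b /\ forall p, List.In p L -> ~ p b.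
Proof.
move=> iI Lp IL.
have [||||b Ib bG] := @prime_moving R^o I (fun p b => ~ p b) L _ _ Lp.
- exact: ideal0.
- by move=> s v w Iv Iw; apply: idealD => //; apply: idealM.
- move=> p s v w /Lp[ip _ _] ps npv pvw; apply: npv.
  by rewrite -[v](addrK (s *: w)); apply: idealB => //; apply: idealMl.
- move=> p b pL Ib /contrapT pb; have [c [Ic pc]] := IL p pL; exists c => //.
  move=> s ps pbsc; have [ip _ _] := Lp p pL.
  apply: (prime_notM (Lp p pL) ps pc).
  by rewrite -[_ * _](addKr b); apply: idealD => //; apply: idealN.
- by exists b.
Qed.

Hypothesis noethR : noetherian R.

(** Maximal annihilators [colon N u] are prime. Finitely many of these [u] span all the others. If
    no annihilator of a spanning element lay in that of [u], a product of elements killing the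
    spanning ones in turn would kill [u], though none of its factors does. *)
Lemma zero_divisor_primes N : is_ideal N ->
  exists L : seq (R -> Prop),
    (forall p, List.In p L -> prime_id p /\ exists u, ~ N u /\ p = colon N u) /\
    (forall c, ~ nzd_mod N c -> exists2 p, List.In p L & p c).
Proof.
move=> iN.
pose mx u := ~ N u /\ forall v, ~ N v -> (forall c, N (c * u) -> N (c * v)) ->
  forall c, N (c * v) -> N (c * u).
have mxP u : mx u -> prime_id (colon N u).
  move=> [nu umax]; split; first exact: is_ideal_colon.
    by rewrite /colon mul1r.
  move=> a b abu; case: (pselect (N (b * u))) => bu; [by right|left].
  apply: (umax (b * u)) => //; last by rewrite mulrA.
  by move=> c cu; rewrite mulrCA; apply: idealM.
have mxex v : ~ N v -> exists u, mx u /\ forall c, N (c * v) -> N (c * u).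
  move=> nv.
  have [|I [u [nu [-> vu]]]|I [[u [nu [-> vu]]] umax]] :=
    @ideal_maximal R noethR (fun I => exists u, ~ N u /\ I = colon N u /\
       forall c, N (c * v) -> N (c * u)).
  - by exists (colon N v), v.
  - exact: is_ideal_colon.
  - exists u; split=> //; split=> // w nw uw; apply: (umax (colon N w)) => //.
    by exists w; split=> //; split=> // c /vu/uw.
pose span := foldr (fun u J => adjoin J u) (fun x : R => x = 0).
have span_ideal l : is_ideal (span l).
  by elim: l => [|u l IH] /=; [exact: is_ideal0 | exact: is_ideal_adjoin].
have [|_ [l [_ ->]]|_ [[l [lmx ->]] lmax]] := @ideal_maximal R noethR
  (fun I => exists l, (forall u, List.In u l -> mx u) /\ I = span l).
- by exists (span [::]), [::].
- exact: span_ideal.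
have mxl u : mx u -> span l u.
  move=> mu; apply: (lmax (span (u :: l))).
  - by exists (u :: l); split=> // v [<-//|]; apply: lmx.
  - by move=> x; apply: adjoin_sub.
  - exact: adjoin_gen.
exists (map (colon N) l); split=> [p /List.in_map_iff[u [<- ul]]|c /existsNP].
  by split; [apply/mxP/lmx | exists u; split=> //; case: (lmx u ul)].
move=> [v /not_implyP[cv nv]].
have [u [mu vu]] := mxex v nv.
suff [w wl wu] : exists2 w, List.In w l & forall c, N (c * w) -> N (c * u).
  exists (colon N w); first exact: List.in_map.
  by apply: ((lmx w wl).2 u mu.1 wu); apply: vu.
apply: contrapT => noW.
have {}noW w : List.In w l -> exists c, N (c * w) /\ ~ N (c * u).
  move=> wl; apply: contrapT => h; apply: noW; exists w => // e we.
  by apply: contrapT => eu; apply: h; exists e.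
have [d [dl du]] : exists d, (forall x, span l x -> N (d * x)) /\ ~ N (d * u).
  elim: (l) noW => [|w l1 IH] lW.
    exists 1; split; first by move=> x ->; rewrite mulr0; apply: ideal0.
    by rewrite mul1r; case: mu.
  have [|d [dl du]] := IH; first by move=> x xl; apply: lW; right.
  have [|e [ew eu]] := lW w; first by left.
  exists (d * e); split; last exact: (prime_notM (mxP u mu) du eu).
  move=> x [a /dl dxa].
  have -> : d * e * x = e * (d * (x - w * a)) + (d * a) * (e * w) by ring.
  by apply: idealD => //; apply: idealM.
exact/du/dl/mxl.
Qed.

Lemma nzd_mod_avoidance N : is_ideal N ->
  exists L : seq (R -> Prop),
    (forall p, List.In p L -> prime_id p /\ exists u, ~ N u /\ p = colon N u) /\
    (forall I, is_ideal I ->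
      (forall p, List.In p L -> exists c, I c /\ ~ p c) ->
      exists b, I b /\ nzd_mod N b).
Proof.
move=> iN; have [L [Lp Lz]] := zero_divisor_primes iN.
exists L; split=> // I iI IL.
have [|//|b [Ib bL]] := prime_avoidance iI (L := L); first by move=> p /Lp[].
exists b; split=> //; apply: contrapT => /Lz[p pL pb].
exact: bL pb.
Qed.

End Primes.

(** * Regular sequences and grade *)

Section RegularSequences.
Variable R : comNzRingType.
Implicit Types (I J N p : R -> Prop) (a b c u x y : R).

(* N need not be a proper ideal. *)
Inductive reg_seq I : nat -> (R -> Prop) -> Prop :=
| RegNil : reg_seq I 0 (fun x => x = 0)
| RegSnoc t N b : reg_seq I t N -> I b -> nzd_mod N b ->
    reg_seq I t.+1 (adjoin N b).

Definition grade_ge I t := exists N, reg_seq I t N.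

(* An ideal has grade greater than t iff it lies in none of these primes. *)
Definition assoc_prime t p := prime_id p /\ exists j N u,
  [/\ (j <= t)%N, reg_seq (fun=> True) j N, ~ N u & p = colon N u].

(** A regular sequence on R/N unfolded from its first element, as the induction for Ext needs it;
    [reg_seq] exposes the last one. *)
Fixpoint grade_mod I t N := if t is t'.+1 then
    exists b, [/\ I b, nzd_mod N b & grade_mod I t' (adjoin N b)]
  else True.

Lemma reg_ideal I t N : reg_seq I t N -> is_ideal N.
Proof.
by elim=> [|j N' b _ iN _ _]; [exact: is_ideal0 | exact: is_ideal_adjoin].
Qed.

Lemma reg_sub I J t N : (forall x, I x -> J x) -> reg_seq I t N -> reg_seq J t N.
Proof.
move=> IJ; elim=> [|j N' b _ rN Ib bN]; first exact: RegNil.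
by apply: RegSnoc => //; apply: IJ.
Qed.

Lemma reg_grade_mod I j t N : reg_seq I j N -> grade_mod I t N ->
  grade_mod I (j + t) (fun x => x = 0).
Proof.
move=> rN; elim: rN t => [|i N' b _ IH Ib bN] t gt //.
by rewrite addSnnS; apply: IH; exists b.
Qed.

Lemma grade_geE I t : grade_ge I t -> grade_mod I t (fun x => x = 0).
Proof.
by move=> [N rN]; have := @reg_grade_mod I t 0 N rN Logic.I; rewrite addn0.
Qed.

Lemma assoc_primeW s t p : (s <= t)%N -> assoc_prime s p -> assoc_prime t p.
Proof.
move=> st [pP [j [N [u [js rN nu pE]]]]]; split=> //.
by exists j, N, u; split=> //; apply: leq_trans st.
Qed.

Hypothesis noethR : noetherian R.

Lemma grade_avoidance I t : is_ideal I ->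
  (forall s p, (s < t)%N -> assoc_prime s p -> exists c, I c /\ ~ p c) ->
  grade_ge I t.
Proof.
move=> iI; elim: t => [|t IHt] It; first by exists (fun x => x = 0); apply: RegNil.
have [|N rN] := IHt; first by move=> s p /ltnW st; apply: It.
have iN := reg_ideal rN.
have [L [LP LI]] := nzd_mod_avoidance noethR iN.
have [|b [Ib bN]] := LI I iI.
  move=> p /LP[pP [u [nu pu]]]; apply: (It t) => //; split=> //.
  by exists t, N, u; split=> //; apply: reg_sub rN.
by exists (adjoin N b); apply: RegSnoc.
Qed.

End RegularSequences.

(** * Exactness modulo an ideal *)

Section MatricesModIdeal.
Variable R : comNzRingType.
Implicit Types (I J N p : R -> Prop) (a b : R).

Definition mx_in N q k (A : 'M[R]_(q, k)) := forall i j, N (A i j).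

Lemma mx_inD N q k (A B : 'M[R]_(q, k)) :
  is_ideal N -> mx_in N A -> mx_in N B -> mx_in N (A + B).
Proof. by move=> iN NA NB i j; rewrite mxE; apply: idealD. Qed.

Lemma mx_inN N q k (A : 'M[R]_(q, k)) : is_ideal N -> mx_in N A -> mx_in N (- A).
Proof. by move=> iN NA i j; rewrite mxE; apply: idealN. Qed.

Lemma mx_inMr N q k l (A : 'M[R]_(q, k)) (B : 'M_(k, l)) :
  is_ideal N -> mx_in N A -> mx_in N (A *m B).
Proof.
by move=> iN NA i j; rewrite mxE; apply: ideal_sum => // h _; apply: idealMl.
Qed.

Lemma mx_inZ N q k a (A : 'M[R]_(q, k)) :
  is_ideal N -> mx_in N A -> mx_in N (a *: A).
Proof. by move=> iN NA i j; rewrite mxE; apply: idealM. Qed.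

Lemma mx_in_eq0 q k (A : 'M[R]_(q, k)) : mx_in (fun x => x = 0) A <-> A = 0.
Proof.
split=> [A0|-> i j]; last by rewrite mxE.
by apply/matrixP => i j; rewrite mxE; apply: A0.
Qed.

Lemma mx_in_nzd N b q k (A : 'M[R]_(q, k)) :
  nzd_mod N b -> mx_in N (b *: A) -> mx_in N A.
Proof. by move=> bN NA i j; apply: bN; have := NA i j; rewrite mxE. Qed.

Lemma mx_in_adjoin N b q k (A : 'M[R]_(q, k)) :
  mx_in (adjoin N b) A <-> exists Y, mx_in N (A - b *: Y).
Proof.
split=> [h|[Y h] i j]; last by exists (Y i j); have := h i j; rewrite !mxE.
have /choice[Y YP] (i : 'I_q) : exists y : 'I_k -> R, forall j, N (A i j - b * y j).
  by have [y yP] := choice (h i); exists y.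
by exists (\matrix_(i, j) Y i j) => i j; rewrite !mxE.
Qed.

(* Exactness modulo N of R^q --A--> im E --B--> R^l, for an idempotent E. *)
Definition exact_mod N k (E : 'M[R]_k) q l (A : 'M[R]_(q, k)) (B : 'M[R]_(k, l)) :=
  forall v : 'rV_k, mx_in N (v *m B) -> exists y, mx_in N (v *m E - y *m A).

(** The long exact sequence of multiplication by [b], done by hand: exactness modulo the larger
    ideal costs exactness modulo [N] at one further place to the right. *)
Lemma exact_mod_shift N b k1 k2 q l (E2 : 'M[R]_k1) (E3 : 'M[R]_k2)
    (A : 'M[R]_(q, k1)) (B : 'M[R]_(k1, k2)) (C : 'M[R]_(k2, l)) :
  is_ideal N -> nzd_mod N b -> B *m E3 = B -> B *m C = 0 ->
  exact_mod N E2 A B -> exact_mod N E3 B C -> exact_mod (adjoin N b) E2 A B.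
Proof.
move=> iN bN BE BC exAB exBC v /mx_in_adjoin[y vBy].
have /exBC[z yz] : mx_in N (y *m C).
  apply: (mx_in_nzd bN).
  have -> : b *: (y *m C) = - ((v *m B - b *: y) *m C).
    by rewrite mulmxBl -mulmxA BC mulmx0 sub0r opprK scalemxAl.
  by apply: mx_inN => //; apply: mx_inMr.
have /exAB[w vw] : mx_in N ((v - b *: z) *m B).
  have -> : (v - b *: z) *m B =
      b *: (y *m E3 - z *m B) + (v *m B - b *: y) *m E3.
    rewrite !mulmxBl -[v *m B *m E3]mulmxA BE scalerBr -!scalemxAl.
    by rewrite [RHS]addrC addrA subrK.
  by apply: mx_inD => //; [apply: mx_inZ | apply: mx_inMr].
exists w; apply/mx_in_adjoin; exists (z *m E2).
by move: vw; rewrite mulmxBl scalemxAl addrAC.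
Qed.

Lemma exact_mod0 k q l (E : 'M[R]_k) (A : 'M[R]_(q, k)) (B : 'M[R]_(k, l)) :
  (forall v : 'rV_k, v *m B = 0 -> exists y, v *m E = y *m A) <->
  exact_mod (fun x => x = 0) E A B.
Proof.
split=> ex v /mx_in_eq0 /ex[y vy]; exists y.
  by apply/mx_in_eq0; rewrite vy subrr.
by apply/subr0_eq/mx_in_eq0.
Qed.

End MatricesModIdeal.

(** * Finitely generated syzygies and free resolutions *)

Section Syzygies.
Variable R : comNzRingType.

Definition submodule k (S : 'rV[R]_k -> Prop) :=
  S 0 /\ forall a v w, S v -> S w -> S (a *: v + w).

Hypothesis noethR : noetherian R.

(** Induction on [k]: the first coordinates form an ideal, and the vectors with first coordinate 0 a
    submodule with one coordinate fewer. *)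
Lemma submodule_fg k (S : 'rV[R]_k -> Prop) : submodule S ->
  exists q (B : 'M[R]_(q, k)), forall v, S v <-> exists y, v = y *m B.
Proof.
elim: k S => [|k IHk]; last rewrite -(add1n k); move=> S [S0 SD].
  exists 0%N, 0 => v; split=> [_|_]; last by rewrite (thinmx0 v).
  by exists 0; rewrite (thinmx0 v) mul0mx.
have iS : is_ideal (fun a : R => exists v : 'rV_k, S (row_mx a%:M v : 'rV_(1 + k))).
  split=> [|a b [v Sv] [w Sw]|a b [v Sv]].
  - by exists 0; rewrite raddf0 row_mx0.
  - exists (v + w); have := SD 1 _ _ Sv Sw.
    by rewrite scale1r add_row_mx -raddfD.
  - exists (a *: v); have := SD a _ _ Sv S0.
    by rewrite addr0 scale_row_mx scale_scalar_mx.
have [n [c cP]] := noethR iS.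
have [|q [B BP]] := IHk (fun v => S (row_mx 0 v : 'rV_(1 + k))).
  split=> [|a v w Sv Sw]; first by rewrite row_mx0.
  by have := SD a _ _ Sv Sw; rewrite scale_row_mx add_row_mx scaler0 addr0.
have /choice[s sS] (i : 'I_n) : exists v : 'rV_k, S (row_mx (c i)%:M v : 'rV_(1 + k)).
  apply/cP; exists (fun j => (j == i)%:R).
  rewrite (bigD1 i) //= eqxx mul1r big1 ?addr0 // => j /negPf->.
  by rewrite mul0r.
have S_sum (r : seq 'I_n) (F : 'I_n -> 'rV_(1 + k)) :
    (forall i, S (F i)) -> S (\sum_(i <- r) F i).
  move=> SF; elim/big_rec: _ => // i x _ Sx.
  by have := SD 1 _ _ (SF i) Sx; rewrite scale1r.
have SZ a (v : 'rV_(1 + k)) : S v -> S (a *: v).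
  by move=> Sv; have := SD a _ _ Sv S0; rewrite addr0.
pose G : 'M[R]_(n, 1 + k) := \matrix_i (row_mx (c i)%:M (s i) : 'rV_(1 + k)).
have SG (y : 'rV_n) : S (y *m G).
  by rewrite mulmx_sum_row; apply: S_sum => i; apply: SZ; rewrite rowK.
exists (n + q)%N, (col_mx G (row_mx 0 B : 'M_(q, 1 + k))) => v.
split=> [Sv|[y ->]]; last first.
  rewrite -[y]hsubmxK mul_row_col addrC -[rsubmx y *m _]scale1r.
  apply: SD (SG _); rewrite mul_mx_row mulmx0.
  by apply/BP; exists (rsubmx y).
have [y yP] : exists y : 'I_n -> R, v 0 0 = \sum_i y i * c i.
  apply/cP; exists (rsubmx (v : 'rV_(1 + k))).
  suff -> : (v 0 0)%:M = lsubmx (v : 'rV_(1 + k)) by rewrite hsubmxK.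
  apply/matrixP => i j; rewrite !ord1 !mxE /=; congr (v _ _).
  exact: val_inj.
pose y' : 'rV[R]_n := \row_(i < n) y i.
have lv : lsubmx ((v : 'rV_(1 + k)) - y' *m G) = 0.
  apply/matrixP => i j; rewrite !ord1 !mxE.
  apply/eqP; rewrite subr_eq0; apply/eqP.
  have -> : lshift k (0 : 'I_1) = 0 :> 'I_(1 + k) by apply: val_inj.
  rewrite yP; apply: eq_bigr => h _; rewrite !mxE.
  case: splitP => j0 // _; by rewrite !mxE !ord1.
have : S ((v : 'rV_(1 + k)) - y' *m G).
  by rewrite addrC -scaleN1r; apply: SD.
rewrite -[_ - _]hsubmxK lv => /BP[z zP].
exists (row_mx y' z); rewrite mul_row_col mul_mx_row mulmx0 -zP -lv hsubmxK.
by rewrite addrC subrK.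
Qed.

Lemma left_kernel_fg k l (A : 'M[R]_(k, l)) :
  exists q (B : 'M[R]_(q, k)), forall v : 'rV_k,
    v *m A = 0 <-> exists y, v = y *m B.
Proof.
apply: submodule_fg; split=> [|a v w vA wA]; first exact: mul0mx.
by rewrite mulmxDl -scalemxAl vA wA scaler0 addr0.
Qed.

(** The first two sizes compute to [l] and [k], so [d 0%N = A] needs no cast. *)
Definition res_size l k (s : nat -> nat) i :=
  match i with 0 => l | 1 => k | j.+2 => s j end.

Lemma free_resolution k l (A : 'M[R]_(k, l)) :
  exists (s : nat -> nat)
         (d : forall i, 'M[R]_(res_size l k s i.+1, res_size l k s i)),
    d 0%N = A /\
    forall i (v : 'rV_(res_size l k s i.+1)),
      v *m d i = 0 <-> exists y, v = y *m d i.+1.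
Proof.
have [ker kerP] : {ker : forall k l, 'M[R]_(k, l) -> {q : nat & 'M[R]_(q, k)} |
    forall k l (A : 'M_(k, l)) (v : 'rV_k),
      v *m A = 0 <-> exists y, v = y *m tagged (ker k l A)}.
  exists (fun k l A => existT _ (projT1 (cid (left_kernel_fg A)))
    (projT1 (cid (projT2 (cid (left_kernel_fg A)))))) => k' l' A'.
  exact: (projT2 (cid (projT2 (cid (left_kernel_fg A'))))).
pose mx := {a : nat & {b : nat & 'M[R]_(b, a)}}.
pose next (M : mx) : mx := existT _ (tag (tagged M)) (ker _ _ (tagged (tagged M))).
pose st n := iter n next (existT _ k (ker _ _ A)).
exists (fun j => tag (tagged (st j))),
  (fun i => match i return 'M[R]_(res_size l k _ i.+1, res_size l k _ i) with
     0 => A | 1 => tagged (tagged (st 0%N)) | j.+2 => tagged (tagged (st j.+1))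
   end).
split=> // -[|[|i]] v; [exact: (kerP _ _ A) | exact: (kerP _ _ (tagged (ker _ _ A))) |].
exact: (kerP _ _ (tagged (tagged (st i.+1)))).
Qed.
End Syzygies.

(** * Vanishing of Ext and torsionless modules *)

Section ExtVanishing.
Variable R : comNzRingType.
Variables (s : nat -> nat) (d : forall i, 'M[R]_(s i.+1, s i)).
Hypothesis exd : forall i (v : 'rV_(s i.+1)),
  v *m d i = 0 <-> exists y, v = y *m d i.+1.
Implicit Types (I N : R -> Prop) (a b : R).

Lemma resolution_lift i n (X : 'M_(n, s i.+1)) :
  X *m d i = 0 -> exists Y, X = Y *m d i.+1.
Proof.
move=> Xd; have h j : exists y, row j X = y *m d i.+1.
  by apply/exd; rewrite -row_mul Xd row0.
have [Y YP] := choice h; exists (\matrix_j Y j).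
by apply/row_matrixP => j; rewrite row_mul rowK.
Qed.

Lemma resolution_comp i : d i.+1 *m d i = 0.
Proof.
apply/row_matrixP => j; rewrite row_mul row0; apply/exd.
by exists (delta_mx 0 j); rewrite -rowE.
Qed.

(* The dual complex, with the zero module in front of it so that Ext^0 is not a
   special case. *)
Definition codim i := if i is j.+1 then s j else 0%N.
Definition codiff i : 'M[R]_(codim i, s i) :=
  match i return 'M_(codim i, s i) with 0 => 0 | j.+1 => (d j)^T end.

(* Ext^i(D, R/N) = 0 for the module D resolved by d. *)
Definition ext_zero N i := exact_mod N 1%:M (codiff i) (d i)^T.

Lemma codiff_comp i : codiff i *m (d i)^T = 0.
Proof.
case: i => [|i] /=; first by rewrite mul0mx.
by rewrite -trmx_mul resolution_comp trmx0.
Qed.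

(** [(codiff i)^T] is the differential leaving degree [i]. Since [a] kills the cokernel of [d 0], a
    null-homotopy is lifted degree by degree. *)
Lemma homotopy a h0 i : a%:M = h0 *m d 0%N ->
  exists h h', a%:M = h *m d i + (codiff i)^T *m h'.
Proof.
move=> ah0; elim: i => [|i [h [h' ah]]].
  by exists h0, 0; rewrite mulmx0 addr0.
have [|g gP] := @resolution_lift i _ (a%:M - d i *m h).
  have -> : (a%:M - d i *m h) *m d i = d i *m (codiff i)^T *m h'.
    rewrite mulmxBl mul_scalar_mx -mul_mx_scalar ah mulmxDr !mulmxA.
    by rewrite addrAC subrr add0r.
  by rewrite -[d i]trmxK -trmx_mul codiff_comp trmx0 mul0mx.
by exists g, h; rewrite /= trmxK -gP subrK.
Qed.

(* Multiplication by an element of I is null-homotopic on the resolution;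
   hence a cocycle modulo N times such an element is a coboundary modulo N. *)
Lemma grade_ext_zero I t N i : is_ideal N ->
  (forall c, I c -> exists h, c%:M = h *m d 0%N) ->
  grade_mod I t N -> (i < t)%N -> ext_zero N i.
Proof.
move=> iN Ih; elim: t N iN i => // t IHt N iN i [b [Ib bN gt]] it w wd.
have [h0 /(homotopy i)[h [h' bh]]] := Ih b Ib.
have bw : mx_in N (b *: w - w *m h'^T *m codiff i).
  have -> : b *: w - w *m h'^T *m codiff i = w *m (d i)^T *m h^T.
    rewrite -mul_mx_scalar -tr_scalar_mx bh raddfD /= !trmx_mul trmxK mulmxDr.
    by rewrite !mulmxA addrK.
  exact: mx_inMr.
case: i it w wd h h' bh bw => [|i] it w wd h h' bh bw.
  exists 0; rewrite mul0mx subr0 mulmx1; apply: (mx_in_nzd bN).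
  by move: bw; rewrite /= mulmx0 subr0.
(* Modulo [adjoin N b], [w *m h'^T] is a cocycle one degree lower. By induction it is a coboundary
   plus [b] times some [Y], and cancelling [b] exhibits [w] as the coboundary of [Y] modulo [N]. *)
have wd' : mx_in (adjoin N b) (w *m h'^T *m (d i)^T).
  apply/mx_in_adjoin; exists w.
  by have := mx_inN iN bw; rewrite opprB.
have [y /mx_in_adjoin[Y YP]] := IHt _ (is_ideal_adjoin b iN) i gt it _ wd'.
exists Y; rewrite mulmx1; apply: (mx_in_nzd bN).
have -> : b *: (w - Y *m codiff i.+1) = b *: w - w *m h'^T *m codiff i.+1 +
   (w *m h'^T *m 1%:M - y *m codiff i - b *: Y) *m codiff i.+1.
  rewrite !mulmxBl mulmx1 -[y *m _ *m _]mulmxA codiff_comp mulmx0 subr0.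
  by rewrite addrA subrK scalerBr scalemxAl.
by apply: mx_inD => //; apply: mx_inMr.
Qed.

Lemma ext_zero_shift I j N i t : reg_seq I j N ->
  (forall h, (h < t)%N -> ext_zero (fun x => x = 0) h) ->
  (i + j < t)%N -> ext_zero N i.
Proof.
move=> rN ex0; elim: rN i => [|h N' b rN' IH _ bN] i; first by rewrite addn0 => /ex0.
move=> it; apply: (exact_mod_shift (reg_ideal rN') bN).
- exact: mulmx1.
- exact: (codiff_comp i.+1).
- by apply: IH; apply: ltn_trans it; rewrite addnS.
- by apply: (IH i.+1); rewrite addSnnS.
Qed.

End ExtVanishing.

Section GradeIndependence.
Variable R : comNzRingType.
Hypothesis noethR : noetherian R.
Implicit Types (I N : R -> Prop).

(* Hom(R/I, R/N) = Ext^j(R/I, R) for a regular sequence of length j. *)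
Lemma grade_independence I t J j N u :
  is_ideal I -> grade_ge I t -> reg_seq J j N -> (j < t)%N ->
  (forall c, I c -> N (c * u)) -> N u.
Proof.
move=> iI gI rN jt Iu; have [k [g gP]] := noethR iI.
have [s [d [d0 exd]]] := free_resolution noethR (\col_i g i : 'M[R]_(k, 1)).
have iN := reg_ideal rN.
have Ih c : I c -> exists h, c%:M = h *m d 0%N.
  move=> /gP[a ->]; exists (\row_i a i); rewrite d0.
  apply/matrixP => i i'; rewrite !ord1 !mxE eqxx mulr1n.
  by apply: eq_bigr => e _; rewrite !mxE.
have ex0 i : (i < t)%N -> ext_zero d (fun x => x = 0) i.
  apply: (grade_ext_zero exd _ Ih); first exact: is_ideal0.
  exact: grade_geE.
have [|y] := ext_zero_shift (i := 0) exd rN ex0 jt (v := u%:M).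
  rewrite mul_scalar_mx d0 => i e; rewrite !mxE mulrC; apply: Iu.
  apply/gP; exists (fun i => (i == e)%:R).
  rewrite (bigD1 e) //= eqxx mul1r big1 ?addr0 // => i' /negPf->.
  by rewrite mul0r.
by rewrite mulmx0 mulmx1 subr0 => /(_ 0 0); rewrite !mxE eqxx mulr1n.
Qed.

Lemma grade_assoc_prime I t s p : is_ideal I -> grade_ge I t -> (s < t)%N ->
  assoc_prime s p -> exists c, I c /\ ~ p c.
Proof.
move=> iI gI st [pP [j [N [u [js rN nu pE]]]]]; apply: contrapT => noc.
apply: nu; apply: (grade_independence iI gI rN); first exact: leq_ltn_trans st.
move=> c Ic; rewrite -[N _]/(colon N u c) -pE; apply: contrapT => pc.
by apply: noc; exists c.
Qed.

End GradeIndependence.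

Section Torsionless.
Variable R : comNzRingType.

Definition row_exact q k l (A : 'M[R]_(q, k)) (B : 'M[R]_(k, l)) :=
  forall v : 'rV_k, v *m B = 0 <-> exists y, v = y *m A.
(** Exactness of the dual sequence, with functionals written as columns. *)
Definition col_exact q k l (A : 'M[R]_(q, k)) (B : 'M[R]_(k, l)) :=
  forall w : 'cV_k, A *m w = 0 <-> exists z, w = B *m z.

(* The cokernel of v |-> v *m A is t-torsionless, cf. m_torsionless. *)
Fixpoint torsionless t q k (A : 'M[R]_(q, k)) : Prop :=
  if t is t'.+1 then exists l (B : 'M[R]_(k, l)),
    [/\ row_exact A B, col_exact A B & torsionless t' B]
  else True.

Lemma col_exact_mx q k l (A : 'M[R]_(q, k)) (B : 'M[R]_(k, l)) n (X : 'M_(k, n)) :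
  col_exact A B -> A *m X = 0 -> exists Y, X = B *m Y.
Proof.
move=> exAB AX; have h j : exists z, col j X = B *m z.
  by apply/exAB; rewrite colE mulmxA AX mul0mx.
have [Y YP] := choice h; exists (\matrix_(i, j) Y j i 0).
apply/matrixP => i j; have := congr1 (fun M : 'cV_k => M i 0) (YP j).
by rewrite !mxE => ->; apply: eq_bigr => e _; rewrite !mxE.
Qed.

Lemma row_exact_comp q k l (A : 'M[R]_(q, k)) (B : 'M[R]_(k, l)) :
  row_exact A B -> A *m B = 0.
Proof.
move=> exAB; apply/row_matrixP => j; rewrite row_mul row0; apply/exAB.
by exists (delta_mx 0 j); rewrite -rowE.
Qed.

Lemma row_exact_trmx q k l (A : 'M[R]_(q, k)) (B : 'M[R]_(k, l)) :
  row_exact B^T A^T -> col_exact A B.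
Proof.
move=> ex w; have -> : A *m w = 0 <-> w^T *m A^T = 0.
  by rewrite -trmx_mul; split=> [->|/(congr1 trmx)]; rewrite ?trmxK trmx0.
split=> [/ex[y wy]|[z ->]]; last by apply/ex; exists z^T; rewrite trmx_mul.
by exists y^T; rewrite -[B]trmxK -trmx_mul -wy trmxK.
Qed.

Lemma torsionless_eqrow t q1 q2 k (A1 : 'M[R]_(q1, k)) (A2 : 'M[R]_(q2, k)) :
  (exists X, A1 = X *m A2) -> (exists Y, A2 = Y *m A1) ->
  torsionless t A1 -> torsionless t A2.
Proof.
move=> [X A12] [Y A21]; case: t => // t [l [B [rAB cAB tB]]].
exists l, B; split=> // v.
  split=> [/rAB[y ->]|[y ->]]; first by exists (y *m X); rewrite -mulmxA -A12.
  by apply/rAB; exists (y *m Y); rewrite -mulmxA -A21.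
rewrite -cAB; split=> Av.
  by rewrite A12 -mulmxA Av mulmx0.
by rewrite A21 -mulmxA Av mulmx0.
Qed.

Lemma torsionless_seq t (s : nat -> nat) (d : forall i, 'M[R]_(s i.+1, s i)) :
  (forall i, (i < t)%N -> row_exact (d i.+1) (d i)) ->
  (forall i, (i < t)%N -> row_exact (d i)^T (d i.+1)^T) ->
  torsionless t (d 0%N)^T.
Proof.
elim: t s d => // t IHt s d rd cd; exists (s 2), (d 1)^T; split.
- exact: cd.
- by apply: row_exact_trmx; rewrite !trmxK; apply: rd.
- by apply: (IHt (fun i => s i.+1) (fun i => d i.+1)) => i it; [apply: rd | apply: cd].
Qed.

(** For [q = x *m B], with the columns of [B] generating the dual of the module, this is the order
    ideal of the class of [x]. *)
Definition entry_ideal l (q : 'rV[R]_l) (c : R) := exists h : 'cV_l, c%:M = q *m h.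

Lemma entry_ideal_ideal l (q : 'rV[R]_l) : is_ideal (entry_ideal q).
Proof.
split=> [|x y [g xg] [h yh]|a x [h xh]].
- by exists 0; rewrite mulmx0 raddf0.
- by exists (g + h); rewrite mulmxDr raddfD /= xg yh.
- by exists (a *: h); rewrite -scalemxAr -xh scale_scalar_mx.
Qed.

Hypothesis noethR : noetherian R.

(* Ext^i(R/I, R) = 0 for i <= t, for I the ideal of the entries of q. *)
Lemma entry_ideal_torsionless t l (q : 'rV[R]_l) :
  grade_ge (entry_ideal q) t.+1 ->
  (forall a, a *: q = 0 -> a = 0) /\ torsionless t q.
Proof.
move=> gq; have [s [d [d0 exd]]] := free_resolution noethR q^T.
have Ih c : entry_ideal q c -> exists h, c%:M = h *m d 0%N.
  by move=> [h ch]; exists h^T; rewrite d0 -trmx_mul -ch tr_scalar_mx.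
have ex0 i : (i < t.+1)%N -> ext_zero d (fun x => x = 0) i.
  apply: (grade_ext_zero exd _ Ih); first exact: is_ideal0.
  exact: grade_geE.
split=> [a aq|].
  have [|y] := (exact_mod0 _ _ _).2 (ex0 0%N isT) a%:M.
    by rewrite mul_scalar_mx d0 trmxK aq.
  rewrite mulmx0 mulmx1 => /(congr1 (fun M : 'M_1 => M 0 0)).
  by rewrite !mxE eqxx mulr1n.
have := @torsionless_seq t _ d; rewrite d0 trmxK; apply=> i it.
  exact: exd.
move=> v; split=> [vd|[y ->]]; last first.
  by rewrite -mulmxA -trmx_mul resolution_comp // trmx0 mulmx0.
have [y] := (exact_mod0 _ _ _).2 (ex0 i.+1 it) v vd.
by rewrite mulmx1 => ->; exists y.
Qed.

End Torsionless.

(** * Torsionless quotients *)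

Section Cone.
Variable R : comNzRingType.

(** The hypothesis extends [h] by a component [h'] with [h *m g' + q *m h' = 0]. The blocks [g'],
    [h'], [q'] satisfy the same hypothesis, so the cone continues to the right. *)
Lemma torsionless_block t a0 b0 a b (g : 'M[R]_(a0, a)) (q : 'M[R]_(b0, b))
    (h : 'M[R]_(b0, a)) :
  torsionless t g -> torsionless t q ->
  (forall z : 'cV_a, g *m z = 0 -> exists y, h *m z = q *m y) ->
  torsionless t (block_mx g 0 h q).
Proof.
elim: t a0 b0 a b g q h => // t IHt a0 b0 a b g q h [a' [g' [rg cg tg]]]
  [b' [q' [rq cq tq]]] hh.
have gg' := row_exact_comp rg; have qq' := row_exact_comp rq.
have [h' hP] : exists h', h *m g' + q *m h' = 0.
  have hcol j : exists y, h *m col j g' = q *m y.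
    by apply: hh; rewrite colE mulmxA gg' mul0mx.
  have [Y YP] := choice hcol; exists (- \matrix_(i, j) Y j i 0).
  apply/eqP; rewrite mulmxN subr_eq0; apply/eqP/matrixP => i j.
  have := congr1 (fun M : 'cV_b0 => M i 0) (YP j); rewrite colE mulmxA -colE mxE => ->.
  by rewrite !mxE; apply: eq_bigr => e _; rewrite !mxE.
have DD' : block_mx g 0 h q *m block_mx g' 0 h' q' = 0.
  by rewrite mulmx_block gg' hP qq' !mul0mx !mulmx0 !addr0 block_mx0.
exists (a' + b')%N, (block_mx g' 0 h' q'); split.
- move=> v; split=> [|[y ->]]; last by rewrite -mulmxA DD' mulmx0.
  rewrite -[v]hsubmxK mul_row_block mulmx0 add0r -row_mx0 => /eq_row_mx[].
  set u := lsubmx v; set w := rsubmx v => uw /rq[w0 wE].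
  have /rg[u0 uE] : (u - w0 *m h) *m g' = 0.
    rewrite mulmxBl -mulmxA -[h *m g'](addrK (q *m h')) hP sub0r mulmxN opprK.
    by rewrite mulmxA -wE.
  exists (row_mx u0 w0); rewrite mul_row_block mulmx0 add0r -wE -uE.
  by rewrite subrK.
- move=> w; split=> [|[z ->]]; last by rewrite mulmxA DD' mul0mx.
  rewrite -[w]vsubmxK mul_block_col mul0mx addr0 -col_mx0 => /eq_col_mx[].
  set u := usubmx w; set v := dsubmx w => /cg[u0 uE] hqv.
  have /cq[v0 vE] : q *m (v - h' *m u0) = 0.
    rewrite mulmxBr mulmxA -[q *m h'](addKr (h *m g')) hP addr0 mulNmx opprK.
    by rewrite -mulmxA -uE addrC.
  exists (col_mx u0 v0); rewrite mul_block_col mul0mx addr0 -uE -vE.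
  by rewrite addrC subrK.
- apply: IHt => // z gz; apply/cq; rewrite mulmxA -[q *m h'](addKr (h *m g')) hP.
  by rewrite addr0 mulNmx -mulmxA gz mulmx0 oppr0.
Qed.

(* A torsionless module stays torsionless modulo an element x whose order
   ideal (the entries of x *m B) has large grade: the new right resolution is
   the mapping cone of the dual of a map to a free resolution of R modulo the
   order ideal, with its contractible part removed. *)
Lemma torsionless_quotient t q0 k1 k l (A : 'M[R]_(q0, k1)) (B : 'M[R]_(k1, l))
    (x : 'rV_k1) (C : 'M_(k1, k)) (S : 'M_(k, k1)) (e : 'cV_k1) :
  row_exact A B -> col_exact A B -> torsionless t B ->
  S *m C = 1%:M -> C *m S = 1%:M - e *m x -> x *m C = 0 ->
  torsionless t.+1 (x *m B) -> torsionless t.+1 (A *m C).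
Proof.
move=> rAB cAB tB SC CS xC [l2 [q1 [rq1 cq1 tq1]]].
have AB := row_exact_comp rAB.
have CSB : C *m S *m B *m q1 = B *m q1.
  rewrite CS mulmxBl mul1mx mulmxBl -(mulmxA e) -(mulmxA e).
  by rewrite (row_exact_comp rq1) mulmx0 subr0.
have AB' : A *m C *m (S *m B *m q1) = 0.
  by rewrite -!mulmxA !(mulmxA C) !mulmxA -!(mulmxA A) CSB mulmxA AB mul0mx.
(* The columns of [q1] generate the functionals vanishing at [x *m B], so those of [B *m q1]
   generate the functionals on the module that vanish at [x]; [S] carries them to the quotient. *)
exists l2, (S *m B *m q1); split.
- move=> v; split=> [|[y ->]]; last by rewrite -mulmxA AB' mulmx0.
  rewrite !mulmxA => /rq1[y]; rewrite mulmxA => vy.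
  have /rAB[u uE] : (v *m S - y *m x) *m B = 0 by rewrite mulmxBl vy subrr.
  exists u; rewrite mulmxA -uE mulmxBl -[v *m S *m C]mulmxA SC mulmx1.
  by rewrite -mulmxA xC mulmx0 subr0.
- move=> w; split=> [|[z ->]]; last by rewrite mulmxA AB' mul0mx.
  rewrite -mulmxA => /cAB[z zE].
  have /cq1[z' z'E] : x *m B *m z = 0 by rewrite -mulmxA -zE mulmxA xC mul0mx.
  by exists z'; rewrite -!mulmxA -z'E -zE mulmxA SC mul1mx.
case: t tB tq1 => // t [l3 [g1 [rg1 cg1 tg1]]] [l4 [q2 [rq2 cq2 tq2]]].
have Bg1 := row_exact_comp rg1; have q12 := row_exact_comp rq2.
have [h hE] : exists h, g1 = q1 *m h.
  by apply: col_exact_mx cq1 _; rewrite -mulmxA Bg1 mulmx0.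
exists (l3 + l4)%N, (row_mx h q2); split.
- move=> v; split=> [|[y ->]]; last first.
    rewrite mul_mx_row -!mulmxA -hE q12 !mulmx0 Bg1 mulmx0 mulmx0.
    by rewrite row_mx0.
  rewrite mul_mx_row -row_mx0 => /eq_row_mx[vh /rq2[z zE]].
  have /rg1[u uE] : z *m g1 = 0 by rewrite hE mulmxA -zE.
  by exists (u *m C); rewrite zE uE -!mulmxA !(mulmxA C) !mulmxA -!(mulmxA u) CSB.
- move=> w; split=> [Bw|[z ->]]; last first.
    rewrite -[z]vsubmxK mul_row_col mulmxDr !mulmxA -!(mulmxA _ q1) -hE q12.
    by rewrite -(mulmxA _ B) Bg1 !mulmx0 !mul0mx addr0.
  have /cg1[z zE] : B *m (q1 *m w) = 0.
    by rewrite mulmxA -CSB -!mulmxA (mulmxA S) (mulmxA _ q1) Bw mulmx0.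
  have /cq2[y yE] : q1 *m (w - h *m z) = 0.
    by rewrite mulmxBr zE mulmxA -hE subrr.
  by exists (col_mx z y); rewrite mul_row_col -yE addrC subrK.
(* The added rows [row_mx g1 0] equal [q1 *m row_mx h q2], hence are redundant; they produce the
   block form. *)
apply: (@torsionless_eqrow _ _ _ _ _ (block_mx g1 0 h q2)).
- exists (col_mx q1 1%:M); rewrite mul_col_row -hE q12 !mul1mx.
  by [].
- exists (row_mx 0 1%:M); rewrite mul_row_block !mul0mx !mul1mx !add0r.
  by [].
apply: torsionless_block => // z gz; apply/cq2.
by rewrite mulmxA -hE.
Qed.

(** The cokernel gains the summand [R^c], and [B] an identity block which disappears again in the
    next cokernel. *)
Lemma torsionless_pad t q k c (A : 'M[R]_(q, k)) :
  torsionless t A -> torsionless t (row_mx A 0 : 'M_(q, k + c)).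
Proof.
case: t => // t [l [B [rAB cAB tB]]].
have rAB' : row_exact (row_mx A 0 : 'M_(q, k + c)) (block_mx B 0 0 1%:M).
  move=> v; rewrite -[v]hsubmxK mul_row_block !mulmx0 mulmx1 addr0 add0r.
  rewrite -row_mx0; split=> [/eq_row_mx[/rAB[y ->] ->]|[y]].
    by exists y; rewrite mul_mx_row mulmx0.
  rewrite mul_mx_row mulmx0 => /eq_row_mx[-> ->].
  by congr row_mx; apply/rAB; exists y.
exists (l + c)%N, (block_mx B 0 0 1%:M); split=> //.
  move=> w; rewrite -[w]vsubmxK mul_row_col mul0mx addr0.
  split=> [/cAB[z ->]|[z]].
    by exists (col_mx z (dsubmx w)); rewrite mul_block_col !mul0mx mul1mx addr0 add0r.
  rewrite -[z]vsubmxK mul_block_col mul0mx addr0 => /eq_col_mx[-> _].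
  by apply/cAB; exists (usubmx z).
case: t tB => // t [l' [g [rBg cBg tg]]].
have Bg := row_exact_comp rBg.
exists l', (col_mx g 0); split.
- move=> v; rewrite -[v]hsubmxK mul_row_col mulmx0 addr0.
  split=> [/rBg[y ->]|[y]].
    by exists (row_mx y (rsubmx v)); rewrite mul_row_block !mulmx0 mulmx1 addr0 add0r.
  rewrite -[y]hsubmxK mul_row_block mulmx0 addr0 => /eq_row_mx[-> _].
  by apply/rBg; exists (lsubmx y).
- move=> w; rewrite -[w]vsubmxK mul_block_col !mul0mx mul1mx addr0 add0r.
  rewrite -col_mx0; split=> [/eq_col_mx[/cBg[z ->] ->]|[z]].
    by exists z; rewrite mul_col_mx mul0mx.
  rewrite mul_col_mx mul0mx => /eq_col_mx[-> ->].
  by congr col_mx; apply/cBg; exists z.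
apply: torsionless_eqrow tg.
  by exists (row_mx 1%:M 0); rewrite mul_row_col mul1mx mul0mx addr0.
by exists (col_mx 1%:M 0); rewrite mul_col_mx mul1mx mul0mx.
Qed.

End Cone.

(** * Ranks and splittings at primes *)

Section FieldRank.
Variable K : fieldType.

Lemma row_free_rowsub w l q (f : 'I_w -> 'I_l) (A : 'M[K]_(l, q)) :
  injective f -> row_free A -> row_free (rowsub f A).
Proof.
move=> injf /row_freeP[B AB]; apply/row_freeP; exists (B *m colsub f 1%:M).
rewrite rowsubE mulmxA -(mulmxA _ A) AB mulmx1; apply/matrixP => i j.
rewrite !mxE (bigD1 (f i)) //= !mxE eqxx mul1r (inj_eq injf) big1 ?addr0 //.
by move=> e /negPf ei; rewrite !mxE eq_sym ei mul0r.
Qed.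

Lemma rank_minor w l q (A : 'M[K]_(l, q)) :
  (w <= \rank A)%N <->
  exists (f : 'I_w -> 'I_l) (g : 'I_w -> 'I_q), \det (mxsub f g A) != 0.
Proof.
split=> [wA|[f [g]]]; last first.
  rewrite -unitfE -unitmxE -row_free_unit => /eqnP {1}<-.
  rewrite -[f]/(f \o id)%FUN -[g]/(id \o g)%FUN.
  have -> : mxsub f g A = rowsub f 1%:M *m A *m colsub g 1%:M.
    by rewrite -rowsubE mulmx_colsub mulmx1; apply/matrixP => i j; rewrite !mxE.
  by apply: leq_trans (mxrankM_maxl _ _) _; apply: mxrankM_maxr.
pose f := (maxrankfun A \o widen_ord wA)%FUN.
have fA : row_free (rowsub f A).
  have -> : rowsub f A = rowsub (widen_ord wA) (rowsub (maxrankfun A) A).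
    by apply/matrixP => i j; rewrite !mxE.
  apply: row_free_rowsub (maxrowsub_free A) => i j /(congr1 val) /= ij.
  exact: val_inj.
have fT : row_full (rowsub f A)^T by rewrite /row_full mxrank_tr.
exists f, (fullrankfun fT); rewrite -unitfE -unitmxE -row_free_unit.
have -> : mxsub f (fullrankfun fT) A = (rowsub (fullrankfun fT) (rowsub f A)^T)^T.
  by apply/matrixP => i j; rewrite !mxE.
by rewrite /row_free mxrank_tr mxrank_fullrowsub.
Qed.

(* A relation between the rows of Z expresses z through the rows of the modified
   matrix. *)
Lemma absorb_row l q (Z : 'M[K]_(l, q)) (z : 'rV_q) :
  (\rank Z < l)%N -> exists i : 'I_l, forall s : K, s != 0 ->
    (\rank (col_mx z Z) <= \rank (Z + s *: ((delta_mx i 0 : 'cV_l) *m z))%R)%N.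
Proof.
move=> Zl; have /rowV0Pn[y /sub_kermxP yZ y0] : kermx Z != 0.
  by rewrite kermx_eq0 /row_free neq_ltn Zl.
have [i yi] : exists i, y 0 i != 0.
  apply/existsP; apply: contraR y0; rewrite negb_exists => /forallP y0.
  by apply/eqP/rowP => i; rewrite mxE; apply/eqP; have := y0 i; rewrite negbK.
exists i => s s0; set Z' := Z + _.
have zZ' : (z <= Z')%MS.
  have yZ' : y *m Z' = (s * y 0 i) *: z.
    rewrite mulmxDr yZ add0r -scalemxAr mulmxA -colE -scalerA.
    by congr (_ *: _); apply/rowP => j; rewrite !mxE big_ord1 !mxE.
  have sy : s * y 0 i != 0 by rewrite mulf_neq0.
  by rewrite -(eqmx_scale _ sy) -yZ' submxMl.
apply: mxrankS; rewrite col_mx_sub zZ' /=.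
rewrite -[X in (X <= _)%MS](addrK (s *: ((delta_mx i 0 : 'cV_l) *m z))).
rewrite addmx_sub ?submx_refl //.
by rewrite -scaleNr scalemx_sub // mulmx_sub.
Qed.

Lemma rank_add_row l q (Z : 'M[K]_(l, q)) (z : 'rV_q) (c : 'cV_l) :
  (\rank (col_mx z Z) <= (\rank (Z + c *m z)%R).+1)%N.
Proof.
have -> : col_mx z Z = col_mx z 0 + col_mx 0 (Z + c *m z) - col_mx 0 (c *m z).
  by rewrite opp_col_mx !add_col_mx oppr0 !addr0 add0r addrK.
have -> : col_mx z 0 + col_mx 0 (Z + c *m z) - col_mx 0 (c *m z) =
    col_mx 1%:M (- c) *m z + col_mx 0 1%:M *m (Z + c *m z).
  rewrite !mul_col_mx !mul0mx !mul1mx opp_col_mx !add_col_mx oppr0 !addr0 add0r.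
  by rewrite mulNmx addrC addrCA.
apply: leq_trans (mxrank_add _ _) _; rewrite -[X in (_ <= X)%N]add1n leq_add //.
  by apply: leq_trans (mxrankM_maxr _ _) _; apply: rank_leq_row.
exact: mxrankM_maxr.
Qed.

Lemma left_inverse_on k l n (P : 'M[K]_(k, n)) (B : 'M[K]_(n, l)) :
  (forall v : 'rV_k, v *m P *m B = 0 -> v *m P = 0) ->
  exists h, P = P *m B *m h.
Proof.
move=> inj; have : (P^T <= (P *m B)^T)%MS.
  rewrite submxE; set c := cokermx _.
  have cPB : c^T *m P *m B = 0.
    by apply: trmx_inj; rewrite -mulmxA trmx_mul trmxK mulmx_coker trmx0.
  apply/eqP/trmx_inj; rewrite trmx_mul trmxK trmx0.
  apply/row_matrixP => i; rewrite row_mul row0; apply: inj.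
  by rewrite -!row_mul cPB row0.
move=> /submxP[h hP]; exists h^T.
by apply: trmx_inj; rewrite trmx_mul trmxK.
Qed.

End FieldRank.

Section Residue.
Variables (R : comNzRingType) (p : R -> Prop) (K : fieldType).
Variable phi : {rmorphism R -> K}.
Hypothesis phiP : residue p phi.

Lemma residueN a : ~ p a <-> phi a != 0.
Proof.
rewrite -phiP.1; split=> [h|/eqP//]; exact/eqP.
Qed.

Lemma residue_mx q k (A : 'M[R]_(q, k)) : map_mx phi A = 0 <-> mx_in p A.
Proof.
split=> [A0 i j|pA].
  by apply/phiP.1; have := congr1 (fun M : 'M_(q, k) => M i j) A0; rewrite !mxE.
by apply/matrixP => i j; rewrite !mxE; apply/phiP.1.
Qed.

Lemma residue_clear q k (X : 'M[K]_(q, k)) :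
  exists t Y, phi t != 0 /\ phi t *: X = map_mx phi Y.
Proof.
have [b bP] : exists b : 'I_q * 'I_k -> R, forall ij, phi (b ij) != 0 /\
    exists a, X ij.1 ij.2 = phi a / phi (b ij).
  have h (ij : 'I_q * 'I_k) : exists b, phi b != 0 /\
      exists a, X ij.1 ij.2 = phi a / phi b.
    by have [a [b [b0 ->]]] := phiP.2 (X ij.1 ij.2); exists b; split=> //; exists a.
  by have [b bP] := choice h; exists b.
pose t := \prod_ij b ij.
have h i j : exists y, phi t * X i j = phi y.
  have [b0 [a ->]] := bP (i, j); rewrite /t (bigD1 (i, j)) //=.
  exists (a * \prod_(ij | ij != (i, j)) b ij).
  by rewrite !rmorphM /= mulrCA [phi (b _) * _]mulrC mulfK // mulrC.
have [Y YP] : exists Y : 'I_q * 'I_k -> R, forall ij, phi t * X ij.1 ij.2 = phi (Y ij).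
  by have [Y YP] := choice (fun ij : 'I_q * 'I_k => h ij.1 ij.2); exists Y.
exists t, (\matrix_(i, j) Y (i, j)); split.
  by rewrite rmorph_prod; apply/prodf_neq0 => ij _; case: (bP ij).
by apply/matrixP => i j; rewrite !mxE -(YP (i, j)).
Qed.

End Residue.

Section RankAtPrime.
Variable R : comNzRingType.
Implicit Types (p N : R -> Prop).

(** The rank over the residue field at [p], expressed by minors over [R] so that no residue field
    has to be chosen. *)
Definition rank_ge p w l q (A : 'M[R]_(l, q)) :=
  exists (f : 'I_w -> 'I_l) (g : 'I_w -> 'I_q), ~ p (\det (mxsub f g A)).

(* The radical of the ideal of w-minors of A. *)
Definition minor_ideal w l q (A : 'M[R]_(l, q)) c :=
  forall p, prime_id p -> ~ rank_ge p w A -> p c.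

(* The cokernel of A is free over the local ring at p. *)
Definition split_at p q k (A : 'M[R]_(q, k)) :=
  exists s H, ~ p s /\ A *m H *m A = s *: A.

Lemma rank_geP p w l q (A : 'M[R]_(l, q)) (K : fieldType) (phi : {rmorphism R -> K}) :
  residue p phi -> rank_ge p w A <-> (w <= \rank (map_mx phi A))%N.
Proof.
move=> phiP; rewrite rank_minor; split=> -[f [g fg]]; exists f, g; move: fg;
  by rewrite -map_mxsub det_map_mx (residueN phiP).
Qed.

Lemma minor_ideal_ideal w l q (A : 'M[R]_(l, q)) : is_ideal (minor_ideal w A).
Proof.
split=> [p [ip _ _] _|x y hx hy p pP np|a x hx p pP np].
- exact: ideal0.
- by apply: idealD; [case: pP | apply: hx | apply: hy].
- by apply: idealM; [case: pP | apply: hx].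
Qed.

Lemma minor_idealP p w l q (A : 'M[R]_(l, q)) : prime_id p ->
  rank_ge p w A <-> exists c, minor_ideal w A c /\ ~ p c.
Proof.
move=> pP; split=> [[f [g fg]]|[c [Ac pc]]].
  exists (\det (mxsub f g A)); split=> // p' p'P np'; apply: contrapT => h.
  by apply: np'; exists f, g.
by apply: contrapT => np; apply: pc; apply: Ac.
Qed.

(* If the sequence A, B is exact modulo N, and p is associated to R/N, then a
   splitting of A at p propagates to B: on the complement of im A cut out
   by P the map B is injective modulo p, thus split injective at p by
   Nakayama's lemma (in the form of the determinant trick). *)
Lemma split_at_exact p N u q k l (E : 'M[R]_k) (A : 'M[R]_(q, k))
    (B : 'M[R]_(k, l)) (K : fieldType) (phi : {rmorphism R -> K}) :
  is_ideal N -> p = colon N u -> prime_id p -> residue p phi ->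
  E *m E = E -> A *m E = A -> E *m B = B -> A *m B = 0 ->
  exact_mod N E A B -> split_at p A ->
  split_at p B /\
  (\rank (map_mx phi E) <= \rank (map_mx phi A) + \rank (map_mx phi B))%N.
Proof.
move=> iN pE pP phiP EE AE EB AB exAB [s [H [ps AHA]]].
have ip : is_ideal p by case: pP.
have pu n1 n2 (M : 'M_(n1, n2)) : mx_in p M <-> mx_in N (u *: M).
  by rewrite pE; split=> h i j; have := h i j; rewrite /colon !mxE mulrC.
(* [s] times a projection of im [E] along im [A]. *)
pose P := s *: E - E *m H *m A.
have AP : A *m P = 0.
  by rewrite mulmxBr -scalemxAr !mulmxA AE AHA subrr.
have PE : P *m E = P by rewrite mulmxBl -scalemxAl EE -(mulmxA _ A) AE.
have EP : E *m P = P by rewrite mulmxBr -scalemxAr EE !mulmxA EE.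
have PB : P *m B = s *: B.
  by rewrite mulmxBl -scalemxAl EB -!mulmxA AB !mulmx0 subr0.
have PP : P *m P = s *: P.
  by rewrite {1}/P mulmxBl -scalemxAl EP -!mulmxA AP !mulmx0 subr0.
have sE : s *: E = P + E *m H *m A by rewrite subrK.
clearbody P.
(* As [p] is the annihilator of [u] modulo [N], multiplication by [u] turns congruences modulo [p]
   into congruences modulo [N], where exactness applies. *)
have inj (v : 'rV_k) : mx_in p (v *m P *m B) -> mx_in p (v *m P).
  move=> /pu; rewrite scalemxAl => /exAB[y yv].
  have : mx_in N ((u *: (v *m P) *m E - y *m A) *m P) by apply: mx_inMr.
  rewrite mulmxBl -[y *m A *m P]mulmxA AP mulmx0 subr0.
  rewrite -!scalemxAl -(mulmxA v) PE -mulmxA PP -scalemxAr => /pu h i j.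
  have := h i j; rewrite mxE; case: pP => _ _ pr; move=> /pr[] //.
have phis : phi s != 0 by apply/(residueN phiP).
have [h hP] : exists h, map_mx phi P = map_mx phi P *m map_mx phi B *m h.
  apply: left_inverse_on => v vPB.
  have [t [Y [t0 tv]]] := residue_clear phiP v.
  have : mx_in p (Y *m P *m B).
    by apply/(residue_mx phiP); rewrite !map_mxM -tv -!scalemxAl vPB scaler0.
  move=> /inj/(residue_mx phiP); rewrite map_mxM -tv -scalemxAl => /eqP.
  by rewrite scaler_eq0 (negPf t0) => /eqP.
have [t [h0 [t0 th]]] := residue_clear phiP h.
pose Z := P *m B *m h0 - t *: P.
have pZ : mx_in p Z.
  apply/(residue_mx phiP); rewrite map_mxB !map_mxM map_mxZ -th -scalemxAr -hP.
  by rewrite subrr.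
(* [Z] vanishes over the residue field, so [W] becomes a nonzero scalar there and [\det W] is
   outside [p]. The adjugate then gives a left inverse of [B] on im [P] up to the factor
   [\det W]. *)
pose W := (t * s ^+ 2)%:M + Z *m P.
have PZ : P *m Z = s *: Z.
  rewrite mulmxBr scalerBr; congr (_ - _); first by rewrite !mulmxA PP -!scalemxAl.
  by rewrite -scalemxAr PP !scalerA mulrC.
have sW : P *m B *m (s *: h0 *m P) = P *m W.
  have -> : P *m B *m (s *: h0 *m P) = s *: (Z + t *: P) *m P.
    by rewrite subrK mulmxA -scalemxAr.
  rewrite mulmxDr mul_mx_scalar mulmxA PZ scalerDr mulmxDl addrC.
  by rewrite scalerA -scalemxAl PP scalerA; congr (_ *: _ + _); ring.
pose h' := s *: h0 *m P *m \adj W; pose dW := \det W.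
have PBh' : P *m B *m h' = dW *: P.
  by rewrite mulmxA sW -mulmxA mul_mx_adj mul_mx_scalar.
have phidW : phi dW != 0.
  rewrite /dW -det_map_mx map_mxD map_scalar_mx map_mxM.
  move/(residue_mx phiP): pZ => ->; rewrite mul0mx addr0 det_scalar.
  by rewrite expf_neq0 // !rmorphM /= !mulf_neq0.
split.
  exists (dW * s), (s *: h'); split.
    by apply/(residueN phiP); rewrite rmorphM mulf_neq0.
  by rewrite -scalemxAr scalemxAl -PB PBh' -scalemxAl PB scalerA.
have -> : \rank (map_mx phi E) = \rank (map_mx phi (s *: E)).
  by rewrite map_mxZ mxrank_scale_nz.
rewrite sE map_mxD addnC.
apply: leq_trans (mxrank_add _ _) _; apply: leq_add; last first.
  by rewrite map_mxM; apply: mxrankM_maxr.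
rewrite -(mxrank_scale_nz _ phidW) -map_mxZ -PBh' -mulmxA mulmxA PB map_mxM.
apply: leq_trans (mxrankM_maxl _ _) _.
by rewrite map_mxZ; apply: mxrank_scale.
Qed.
End RankAtPrime.

(** * Basic elements *)

Section GenericElement.
Variable R : comNzRingType.
Hypothesis noethR : noetherian R.
Implicit Types (p N : R -> Prop).

(* The rows of Z form a (m+1-j)-fold basic set at all primes of grade j. *)
Definition fold_basic m l q (Z : 'M[R]_(l, q)) := forall w j,
  (w + j = m.+1)%N -> (0 < w <= l)%N -> grade_ge (minor_ideal w Z) j.+1.

Lemma rank_geW p v w l q (A : 'M[R]_(l, q)) : prime_id p -> (v <= w)%N ->
  rank_ge p w A -> rank_ge p v A.
Proof.
move=> /residue_field[K [phi phiP]] vw; rewrite !(rank_geP _ _ phiP).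
exact: leq_trans.
Qed.

Lemma rank_ge_add_row p w l q (z : 'rV[R]_q) (Z : 'M_(l, q)) (c : 'cV_l) :
  prime_id p -> rank_ge p w.+1 (col_mx z Z) -> rank_ge p w (Z + c *m z).
Proof.
move=> /residue_field[K [phi phiP]]; rewrite !(rank_geP _ _ phiP).
rewrite map_col_mx map_mxD map_mxM => /leq_trans/(_ (rank_add_row _ _ _)).
exact.
Qed.

(* Critical primes at level j: only the finitely many associated primes of a
   regular sequence of length j in the ideal where the rank is at most w. *)
Lemma fold_basic_primes m l q (z : 'rV[R]_q) (Z : 'M_(l, q)) t :
  fold_basic m (col_mx z Z) -> exists L : seq (R -> Prop),
    (forall p, List.In p L -> prime_id p) /\
    forall c : 'cV_l, (forall p, List.In p L -> forall w, (w <= l)%N ->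
        rank_ge p w (col_mx z Z) -> rank_ge p w (Z + c *m z)) ->
      forall w j, (w + j = m.+1)%N -> (0 < w <= l)%N -> (j < t)%N ->
        grade_ge (minor_ideal w (Z + c *m z)) j.+1.
Proof.
move=> fZ; elim: t => [|t [L [Lp LP]]]; first by exists [::].
have [/andP[/andP[w0 wl] tm]|wN] :=
    boolP ((0 < m.+1 - t <= l) && (t <= m.+1))%N; last first.
  exists L; split=> // c cL w j wj w0l; rewrite ltnS leq_eqVlt => /orP[/eqP jt|].
    by case/negP: wN; lia.
  exact: LP.
set w := (m.+1 - t)%N in w0 wl.
(* By [rank_ge_add_row] this ideal lies in [minor_ideal w (Z + c *m z)] for every [c]. The sequence
   can thus be fixed before [c], and at this level only the associated primes of R/N constrain
   [c]. *)
have [N rN] : exists N, reg_seq (minor_ideal w.+1 (col_mx z Z)) t N.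
  case: (posnP t) => [->|t0]; first by exists (fun x => x = 0); apply: RegNil.
  by rewrite -[t in reg_seq _ t](prednK t0); apply: fZ; rewrite /w; lia.
have iN := reg_ideal rN.
have [Lt [LtP LtN]] := nzd_mod_avoidance noethR iN.
exists (L ++ Lt); split=> [p /(@List.in_app_or _ L Lt)[/Lp//|/LtP[]//]|c cL].
move=> v j vj v0l; rewrite ltnS leq_eqVlt => /orP[/eqP jt|]; last first.
  by apply: LP => // p pL; apply: cL; apply: (@List.in_or_app _ L Lt); left.
have {v0l vj}-> : v = w by rewrite /w; lia.
rewrite {}jt.
have [|b [Ib bN]] := LtN _ (minor_ideal_ideal w (Z + c *m z)).
  move=> p pLt; have [pP [u [nu pu]]] := LtP p pLt.
  apply/(minor_idealP w _ pP); apply: cL => //.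
    by apply: (@List.in_or_app _ L Lt); right.
  apply/(minor_idealP w _ pP).
  apply: (grade_assoc_prime noethR (t := t.+1) (s := t)) => //.
  - exact: minor_ideal_ideal.
  - by apply: fZ; rewrite /w; lia.
  - split=> //; exists t, N, u; split=> //; exact: reg_sub rN.
exists (adjoin N b); apply: RegSnoc bN => //; apply: reg_sub rN => x xZ p pP np.
by apply: xZ => // /(rank_ge_add_row c pP).
Qed.

(** Each prime of the finite list is repaired by adding a multiple of [z] to a single row, chosen by
    [absorb_row]; [prime_moving] makes the repairs compatible. *)
Lemma fold_basic_step m l q (z : 'rV[R]_q) (Z : 'M_(l, q)) :
  fold_basic m (col_mx z Z) -> exists c : 'cV_l, fold_basic m (Z + c *m z).
Proof.
move=> /(fold_basic_primes m.+1)[L [Lp LP]].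
have [||||c _ cL] := @prime_moving R 'cV[R]_l (fun=> True)
  (fun p c => forall w, (w <= l)%N ->
     rank_ge p w (col_mx z Z) -> rank_ge p w (Z + c *m z)) L _ _ Lp => //.
- move=> p s v d /Lp/residue_field[K [phi phiP]] ps vG w wl /(vG w wl).
  rewrite !(rank_geP _ _ phiP); congr (_ <= \rank _)%N.
  rewrite !map_mxD !map_mxM map_mxD map_mxZ.
  by move/(phiP.1 _).2: ps => ->; rewrite scale0r addr0.
- move=> p v /Lp/residue_field[K [phi phiP]] _ /existsNP[w] /not_implyP[wl].
  move=> /not_implyP[_]; rewrite (rank_geP _ _ phiP) => /negP; rewrite -ltnNge.
  rewrite map_mxD map_mxM => /leq_trans/(_ wl) rkl.
  have [i iP] := absorb_row (map_mx phi z) rkl.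
  exists (delta_mx i 0) => // s ps w' w'l; rewrite !(rank_geP _ _ phiP).
  have s0 : phi s != 0 by apply/(residueN phiP).
  have ez : col_mx (map_mx phi z) (map_mx phi Z + map_mx phi v *m map_mx phi z) =
      block_mx 1%:M 0 (map_mx phi v) 1%:M *m map_mx phi (col_mx z Z).
    by rewrite map_col_mx mul_block_col !mul1mx mul0mx addr0 addrC.
  have ze : map_mx phi (col_mx z Z) = block_mx 1%:M 0 (- map_mx phi v) 1%:M *m
      col_mx (map_mx phi z) (map_mx phi Z + map_mx phi v *m map_mx phi z).
    rewrite map_col_mx mul_block_col !mul1mx mul0mx addr0 mulNmx addrC addrK.
    by [].
  move=> /leq_trans; apply; rewrite ze.
  apply: leq_trans (mxrankM_maxr _ _) _; apply: leq_trans (iP _ s0) _.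
  rewrite map_mxD map_mxM map_mxD map_mxZ map_delta_mx mulmxDl addrA.
  by rewrite scalemxAl.
exists c => w j wj wl; apply: (LP c cL w j wj wl).
by lia.
Qed.

(** The top row is absorbed into the remaining ones, repeatedly. The last row is never absorbed,
    whence its coefficient 1. *)
Lemma fold_basic_element m l q (Z : 'M[R]_(l.+1, q)) : fold_basic m Z ->
  exists x : 'rV_l.+1, x 0 ord_max = 1 /\ grade_ge (minor_ideal 1 (x *m Z)) m.+1.
Proof.
elim: l Z => [|l IHl] Z fZ.
  by exists 1%:M; split; [rewrite [ord_max]ord1 mxE | rewrite mul1mx; apply: fZ].
pose z : 'rV_q := usubmx (Z : 'M_(1 + l.+1, q)).
pose Z1 : 'M_(l.+1, q) := dsubmx (Z : 'M_(1 + l.+1, q)).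
have ZE : Z = col_mx z Z1 by rewrite vsubmxK.
have [|c /IHl[x [x1 gx]]] := @fold_basic_step m l.+1 q z Z1; first by rewrite -ZE.
exists (row_mx (x *m c) x : 'rV_(1 + l.+1)); split.
  rewrite -x1 -(row_mxEr (x *m c) x 0 ord_max).
  by congr (row_mx _ _ _ _); apply: val_inj.
suff -> : (row_mx (x *m c) x : 'rV_(1 + l.+1)) *m (Z : 'M_(1 + l.+1, q)) =
  x *m (Z1 + c *m z) by [].
transitivity (row_mx (x *m c) x *m col_mx z Z1); first by rewrite vsubmxK.
by rewrite mul_row_col addrC -mulmxA -mulmxDr.
Qed.

Lemma generic_element m k q (B : 'M[R]_(k.+1, q)) :
  (forall p, assoc_prime m p -> rank_ge p m.+1 B) ->
  exists x : 'rV_k.+1, x 0 ord_max = 1 /\ grade_ge (entry_ideal (x *m B)) m.+1.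
Proof.
move=> rB; have [|x [x1 gx]] := @fold_basic_element m k q B.
  move=> w j wj w0; apply: grade_avoidance => //; first exact: minor_ideal_ideal.
  move=> s p sj sp; have pP := sp.1; apply/(minor_idealP w _ pP).
  apply: (@rank_geW p w m.+1) => //; first by lia.
  by apply: rB; apply: assoc_primeW sp; lia.
exists x; split=> //; apply: grade_avoidance => //; first exact: entry_ideal_ideal.
move=> s p sm sp; have pP := sp.1.
have := grade_assoc_prime noethR (minor_ideal_ideal _ _) gx sm sp.
move=> /(minor_idealP 1 _ pP)[f [g]]; rewrite det_mx11 mxE => fg.
exists ((x *m B) (f 0) (g 0)); split=> //.
exists (delta_mx (g 0) 0); rewrite -colE; apply/matrixP => i j.
by rewrite !mxE !ord1 eqxx mulr1n.
Qed.

End GenericElement.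

(** * Reduction of the rank *)

Section RankReduction.
Variable R : comNzRingType.
Hypothesis noethR : noetherian R.
Implicit Types (p N : R -> Prop).

(** [r] is the rank of the relations, which the reduction preserves; at critical primes the cokernel
    is free of rank [k - r]. *)
Definition good_pres m r q k (A : 'M[R]_(q, k)) :=
  torsionless m A /\ forall p, assoc_prime m p -> split_at p A /\
    forall (K : fieldType) (phi : {rmorphism R -> K}), residue p phi ->
      \rank (map_mx phi A) = r.

(** The other unit vectors span a complement of Rx: [C] is the quotient map by Rx and [S] its
    section with that image. *)
Lemma unimodular_quotient k (x : 'rV[R]_k.+1) : x 0 ord_max = 1 ->
  exists (C : 'M_(k.+1, k)) (S : 'M_(k, k.+1)) (e : 'cV_k.+1),
    [/\ S *m C = 1%:M, C *m S = 1%:M - e *m x & x *m C = 0].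
Proof.
move=> x1; pose e : 'cV[R]_k.+1 := delta_mx ord_max 0.
pose S : 'M[R]_(k, k.+1) := \matrix_(i, j) (j == lift ord_max i)%:R.
have xe : x *m e = 1%:M.
  by rewrite -colE; apply/matrixP => i j; rewrite !ord1 !mxE x1 eqxx.
have Se : S *m e = 0.
  by rewrite -colE; apply/matrixP => i j; rewrite !mxE (negPf (neq_lift _ _)).
have SS : S *m S^T = 1%:M.
  apply/matrixP => i j; rewrite !mxE (bigD1 (lift ord_max i)) //= !mxE eqxx mul1r.
  rewrite (inj_eq lift_inj) big1 ?addr0 // => h /negPf hi.
  by rewrite !mxE hi mul0r.
have l0 (i : 'I_k) : (lift ord_max i == ord_max :> 'I_k.+1) = false.
  by rewrite eq_sym (negPf (neq_lift _ _)).
have SSe : S^T *m S = 1%:M - e *m e^T.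
  apply/matrixP => i j; rewrite !mxE big_ord1 !mxE !andbT.
  case: (unliftP ord_max i) => [i'|] ->.
    rewrite (bigD1 i') //= !mxE eqxx mul1r big1 => [|h /negPf hi].
      by rewrite addr0 l0 mul0r subr0 eq_sym.
    by rewrite !mxE (inj_eq lift_inj) eq_sym hi mul0r.
  rewrite eqxx mul1r big1 => [|h _]; last first.
    by rewrite !mxE (negPf (neq_lift _ _)) mul0r.
  by rewrite eq_sym subrr.
exists ((1%:M - e *m x) *m S^T), S, e; split.
- by rewrite mulmxBl mul1mx mulmxBr SS -!mulmxA (mulmxA S e) Se mul0mx subr0.
- rewrite -mulmxA SSe mulmxBr mulmx1 mulmxA !mulmxBl mul1mx.
  by rewrite -(mulmxA e x e) xe mulmx1 subrr subr0.
- by rewrite mulmxA mulmxBr mulmx1 mulmxA xe mul1mx subrr mul0mx.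
Qed.

Lemma row_kernel_col_exact q k (A : 'M[R]_(q, k)) :
  exists l (B : 'M[R]_(k, l)), col_exact A B.
Proof.
have [l [B BP]] := left_kernel_fg noethR A^T; exists l, B^T.
by apply: row_exact_trmx; rewrite trmxK.
Qed.

Lemma col_exact_mul0 q k l (A : 'M[R]_(q, k)) (B : 'M[R]_(k, l)) :
  col_exact A B -> A *m B = 0.
Proof.
move=> cAB; apply/trmx_inj/row_matrixP => j; rewrite trmx0 row0 -tr_col colE.
rewrite -mulmxA; apply/trmx_inj; rewrite trmxK trmx0; apply/cAB.
by exists (delta_mx j 0).
Qed.

(** The columns of [s%:M - H *m A] are functionals killing the relations, so this matrix factors
    through [B]; hence [B] and [A] together account for all of [s%:M]. *)
Lemma split_at_rank p q k l (A : 'M[R]_(q, k)) (B : 'M[R]_(k, l))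
    (K : fieldType) (phi : {rmorphism R -> K}) :
  residue p phi -> col_exact A B -> split_at p A ->
  (k <= \rank (map_mx phi B) + \rank (map_mx phi A))%N.
Proof.
move=> phiP cAB [s [H [ps AHA]]].
have [|Z ZE] := col_exact_mx (X := s%:M - H *m A) cAB.
  by rewrite mulmxBr mulmxA AHA mul_mx_scalar subrr.
have s0 : phi s != 0 by apply/(residueN phiP).
rewrite -{1}(mxrank1 K k) -(mxrank_scale_nz _ s0) scalemx1 -map_scalar_mx.
rewrite -[s%:M](subrK (H *m A)) ZE map_mxD.
apply: leq_trans (mxrank_add _ _) _; apply: leq_add; rewrite map_mxM.
  exact: mxrankM_maxl.
exact: mxrankM_maxr.
Qed.

(** With [k.+1] generators, [r + m <= k] says that the cokernel has rank at least [m.+1] at critical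
    primes, as [generic_element] requires. *)
Lemma good_pres_reduce1 m r q k (A : 'M[R]_(q, k.+1)) :
  (r + m <= k)%N -> good_pres m r A -> exists C : 'M_(k.+1, k),
    (forall y : 'rV_q, y *m A *m C = 0 -> y *m A = 0) /\ good_pres m r (A *m C).
Proof.
move=> rmk [tA pA].
have [l [B [cAB tB]]] : exists l (B : 'M_(k.+1, l)), col_exact A B /\
    forall m', m = m'.+1 -> row_exact A B /\ torsionless m' B.
  (* For [m = 0] no embedding of the cokernel is given, but its dual is still finitely generated. *)
  case: (m) tA => [_|m' [l [B [rAB cAB tB]]]].
    by have [l [B cAB]] := row_kernel_col_exact A; exists l, B.
  by exists l, B; split=> // _ [<-].
have AB := col_exact_mul0 cAB.
have rB p : assoc_prime m p -> rank_ge p m.+1 B.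
  move=> mp; have pP := mp.1; have [K [phi phiP]] := residue_field pP.
  have [sA /(_ _ _ phiP) rA] := pA p mp; apply/(rank_geP _ _ phiP).
  by have := split_at_rank phiP cAB sA; rewrite rA; lia.
have [x [x1 gx]] := generic_element noethR rB.
have [C [S [e [SC CS xC]]]] := unimodular_quotient x1.
have [xBinj txB] := entry_ideal_torsionless noethR gx.
exists C; split=> [y yAC|].
  (* A relation lying in Rx is killed by [B]; as only 0 annihilates [x *m B], it vanishes. So
     passing to the quotient by Rx loses no relation. *)
  have yA : y *m A = y *m A *m e *m x.
    apply/eqP; rewrite -subr_eq0 -mulmxA -{1}[y *m A]mulmx1 -mulmxBr -CS mulmxA.
    by rewrite yAC mul0mx.
  have := congr1 (mulmx^~ B) yA; rewrite -2!mulmxA AB mulmx0 [y *m A *m e]mx11_scalar.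
  by rewrite mul_scalar_mx => /esym/xBinj ye0; rewrite yA [_ *m e]mx11_scalar ye0
    mul_scalar_mx scale0r.
split.
  case: (m) tB txB => // m' /(_ _ erefl)[rAB tB] txB.
  exact: torsionless_quotient rAB cAB tB SC CS xC txB.
move=> p mp; have pP := mp.1.
have [c [[h ch] pc]] := grade_assoc_prime noethR (entry_ideal_ideal _) gx (ltnSn m) mp.
(* [w] is a functional on the cokernel with value [c] outside [p] at [x]. It corrects [c *: S] to a
   map [T] that undoes [C] on the relations up to [c]. *)
have [w [Aw xw]] : exists w, A *m w = 0 /\ x *m w = c%:M.
  by exists (B *m h); rewrite !mulmxA AB mul0mx.
pose T := c *: S - S *m w *m x.
have ACT : A *m C *m T = c *: A.
  have ACS : A *m C *m S = A - A *m e *m x by rewrite -mulmxA CS mulmxBr mulmx1 mulmxA.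
  have ACSw : A *m C *m (S *m w *m x) = - (c *: (A *m e *m x)).
    rewrite !mulmxA ACS [(_ - _) *m w]mulmxBl Aw sub0r -(mulmxA (A *m e) x w) xw.
    by rewrite mul_mx_scalar mulNmx -scalemxAl.
  by rewrite mulmxBr -scalemxAr ACSw ACS scalerBr opprK subrK.
have [[s [H [ps AHA]]] rA] := pA p mp; split.
  exists (c * s), (T *m H); split; first exact: prime_notM.
  by rewrite !mulmxA ACT -!scalemxAl AHA -scalemxAl scalerA.
move=> K phi phiP; apply/eqP; rewrite eqn_leq -(rA K phi phiP) map_mxM mxrankM_maxl.
have c0 : phi c != 0 by apply/(residueN phiP).
by rewrite -(mxrank_scale_nz _ c0) -map_mxZ -ACT -map_mxM map_mxM mxrankM_maxl.
Qed.

Lemma good_pres_pad m r q k c (A : 'M[R]_(q, k)) :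
  good_pres m r A -> good_pres m r (row_mx A 0 : 'M_(q, k + c)).
Proof.
move=> [tA pA]; split; first exact: torsionless_pad.
move=> p mp; have [[s [H [ps AHA]]] rA] := pA p mp; split.
  exists s, (col_mx H 0); split=> //.
  by rewrite mul_row_col mulmx0 addr0 mul_mx_row AHA mulmx0 scale_row_mx scaler0.
move=> K phi phiP; rewrite -(rA K phi phiP) map_row_mx map_mx0.
apply/eqP; rewrite eqn_leq; apply/andP; split.
  have -> : row_mx (map_mx phi A) 0 = map_mx phi A *m row_mx 1%:M 0 :> 'M_(q, k + c).
    by rewrite mul_mx_row mulmx1 mulmx0.
  exact: mxrankM_maxl.
have {1}-> : map_mx phi A = (row_mx (map_mx phi A) 0 : 'M_(q, k + c)) *m col_mx 1%:M 0.
  by rewrite mul_row_col mulmx1 mul0mx addr0.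
exact: mxrankM_maxl.
Qed.

Lemma good_pres_reduce m r q k (A : 'M[R]_(q, k)) k' : k' = (r + m)%N ->
  good_pres m r A -> exists C : 'M_(k, k'),
    (forall y : 'rV_q, y *m A *m C = 0 -> y *m A = 0) /\ good_pres m r (A *m C).
Proof.
move=> k'E gA.
have red d (A' : 'M_(q, d + k')) : good_pres m r A' -> exists C : 'M_(d + k', k'),
    (forall y : 'rV_q, y *m A' *m C = 0 -> y *m A' = 0) /\ good_pres m r (A' *m C).
  elim: d A' => [|d IHd] A' gA'.
    by exists 1%:M; split=> [y|]; rewrite mulmx1.
  have [|C [Cinj gC]] := good_pres_reduce1 _ gA'; first by rewrite k'E leq_addl.
  have [C' [C'inj gC']] := IHd _ gC.
  exists (C *m C'); split=> [y|]; rewrite !mulmxA // => yACC.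
  by apply: Cinj; rewrite -mulmxA; apply: C'inj; rewrite !mulmxA.
(* After padding by [k'] columns, [k] single reductions lead to [k'], whatever the initial [k]. *)
have [C [Cinj gC]] := red k _ (good_pres_pad k' gA).
have AE : A *m row_mx 1%:M 0 = row_mx A 0 :> 'M_(q, k + k').
  by rewrite mul_mx_row mulmx1 mulmx0.
exists (row_mx 1%:M 0 *m C); split=> [y|]; last by rewrite mulmxA AE.
rewrite mulmxA -(mulmxA y A) AE => /Cinj.
by rewrite mul_mx_row -row_mx0 => /eq_row_mx[].
Qed.

Lemma torsionlessP t q k (A : 'M[R]_(q, k)) : (0 < t)%N -> torsionless t A ->
  exists l (B : 'M_(k, l)),
    [/\ row_exact A B, col_exact A B & torsionless t.-1 B].
Proof. by case: t. Qed.

(** Each element of the sequence uses up one step of the right resolution, hence [j <= t]. *)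
Lemma torsionless_exact_mod (J : R -> Prop) j N t q k l (A : 'M[R]_(q, k))
    (B : 'M[R]_(k, l)) :
  reg_seq J j N -> (j <= t)%N -> row_exact A B -> torsionless t B ->
  exact_mod N 1%:M A B.
Proof.
move=> rN; elim: rN t q k l A B => [|i N' b rN' IH _ bN] t q k l A B.
  by move=> _ rAB _; apply/exact_mod0 => v /rAB[y vy]; exists y; rewrite mulmx1.
case: t => // t it rAB [l' [g [rBg cBg tg]]].
apply: (exact_mod_shift (reg_ideal rN') bN (mulmx1 B) (row_exact_comp rBg)).
  by apply: (IH t.+1) => //; [apply: ltnW | exists l', g].
exact: (IH t).
Qed.

(** The image of the embedding is the cokernel of [A], of rank [m] at critical primes. It is the new
    relation module, so reducing for [m.-1] leaves m + (m-1) columns. *)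
Lemma good_pres_next m r q k (A : 'M[R]_(q, k)) : (0 < m)%N -> k = (r + m)%N ->
  good_pres m r A ->
  exists B : 'M_(k, m.-1.*2.+1), row_exact A B /\ good_pres m.-1 m B.
Proof.
case: m => // m _ kE [[l [B [rAB cAB tB]]] pA].
have gB : good_pres m m.+1 B.
  split=> // p mp; have pP := mp.1; have [_ [j [N [u [jm rN nu pE]]]]] := mp.
  have [sA rA] := pA p (assoc_primeW (leqnSn m) mp).
  have AB := row_exact_comp rAB.
  have ex := torsionless_exact_mod rN jm rAB tB.
  have sB K phi (phiP : @residue R p K phi) := split_at_exact (reg_ideal rN) pE pP phiP
    (mulmx1 _) (mulmx1 _) (mul1mx _) AB ex sA.
  split=> [|K phi phiP].
    by have [K [phi phiP]] := residue_field pP; apply: (sB _ _ phiP).1.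
  have := (sB _ _ phiP).2; rewrite map_mx1 mxrank1 (rA _ _ phiP).
  have /mulmx0_rank_max : map_mx phi A *m map_mx phi B = 0.
    by rewrite -map_mxM AB map_mx0.
  by rewrite (rA _ _ phiP); lia.
have [|C [Cinj gC]] := good_pres_reduce (k' := m.*2.+1) _ gB; first by lia.
exists (B *m C); split=> // v; rewrite mulmxA -rAB; split=> [/Cinj //|->].
by rewrite mul0mx.
Qed.

(** Here [m] is one less than in the theorem. The new map is inserted at index [m.+1] only,
    transported along the index equation because the sizes depend on the index. *)
Lemma three_generated_tail m q (B : 'M[R]_(q, m.*2.+1)) : good_pres m m.+1 B ->
  exists fs : forall j : nat, 'M[R]_(j.*2.+1, j.*2.-1),
    ((0 < m)%N -> row_exact B (fs m)) /\
    forall j, (0 < j)%N -> (j < m)%N -> row_exact (fs j.+1) (fs j).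
Proof.
elim: m q B => [|m IHm] q B gB; first by exists (fun=> 0).
have [|f [fB gf]] := good_pres_next (ltn0Sn m) _ gB; first by lia.
have [fs [fsm fsP]] := IHm _ f gf.
pose gs j : 'M[R]_(j.*2.+1, j.*2.-1) :=
  if eqVneq j m.+1 is EqNotNeq e then
    ecast i 'M[R]_(i.*2.+1, i.*2.-1) (esym e) f else fs j.
have gsm : gs m.+1 = f.
  by rewrite /gs; case: eqVneq => e; [rewrite (eq_irrelevance e erefl) | case/eqP: e].
have gsj j : (j <= m)%N -> gs j = fs j.
  by rewrite /gs; case: eqVneq => // e; rewrite {1}e ltnn.
exists gs; split=> [_|j j0]; first by rewrite gsm.
rewrite ltnS leq_eqVlt => /orP[/eqP jm|jm].
  by rewrite {}jm in j0 *; rewrite gsm gsj //; apply: fsm.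
by rewrite gsj // gsj ?(ltnW jm) //; apply: fsP.
Qed.

End RankReduction.

(** * Ranks and projective resolutions *)

Section Ranks.
Variable R : comNzRingType.
Implicit Types (p N : R -> Prop).

Lemma rows_factor n q k (X : 'M[R]_(n, k)) (A : 'M[R]_(q, k)) :
  (forall v : 'rV_n, exists y, v *m X = y *m A) -> exists Y, X = Y *m A.
Proof.
move=> XA; have h j : exists y, row j X = y *m A by rewrite rowE.
have [Y YP] := choice h; exists (\matrix_j Y j).
by apply/row_matrixP => j; rewrite row_mul rowK.
Qed.

Lemma nzdM (s t : R) : nzd s -> nzd t -> nzd (s * t).
Proof. by move=> ns nt a; rewrite -mulrA => /ns/nt. Qed.

Lemma nzd1 : nzd (1 : R).
Proof. by move=> a; rewrite mul1r. Qed.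

Lemma nzdX (s : R) n : nzd s -> nzd (s ^+ n).
Proof.
move=> ns; elim: n => [|n IHn]; first exact: nzd1.
by rewrite exprS; apply: nzdM.
Qed.

Lemma common_denominator n q k (V : 'M[R]_(n, k)) (X : 'M[R]_(q, k)) :
  (forall i, exists2 s, nzd s & exists a, s *: row i V = a *m X) ->
  exists2 s, nzd s & exists U, s *: V = U *m X.
Proof.
move=> h; have [s sP] : exists s : 'I_n -> R, forall i, nzd (s i) /\
    exists a, s i *: row i V = a *m X.
  have h' i : exists s, nzd s /\ exists a, s *: row i V = a *m X.
    by have [s ns sa] := h i; exists s.
  by have [s sP] := choice h'; exists s.
exists (\prod_i s i).
  elim/big_ind: _ => [|x y|i _]; [exact: nzd1 | exact: nzdM | by case: (sP i)].
apply: rows_factor => v; rewrite -scalemxAr mulmx_sum_row scaler_sumr.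
have [a aP] := choice (fun i => (sP i).2).
exists (\sum_i (v 0 i * \prod_(j | j != i) s j) *: a i).
rewrite mulmx_suml; apply: eq_bigr => i _.
rewrite -scalemxAl -aP !scalerA (bigD1 i) //=; congr (_ *: _); ring.
Qed.

Lemma det_mulmx_thin n (U : 'M[R]_(n.+1, n)) (X : 'M[R]_(n, n.+1)) :
  \det (U *m X) = 0.
Proof.
have -> : U *m X = (row_mx 0 U : 'M_(n.+1, 1 + n)) *m (col_mx 0 X : 'M_(1 + n, n.+1)).
  by rewrite mul_row_col mul0mx add0r.
rewrite (det_mulmx (row_mx 0 U : 'M_(1 + n))) (expand_det_col _ 0) big1 ?mul0r // => i _.
suff -> : (row_mx 0 U : 'M_(n.+1, 1 + n)) i 0 = 0 by rewrite mul0r.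
transitivity ((row_mx 0 U : 'M_(n.+1, 1 + n)) i (lshift n 0)); last first.
  by rewrite row_mxEl mxE.
by congr (row_mx _ _ _ _); apply: val_inj.
Qed.

Lemma scalar_factor_le k n (s : R) (U : 'M_(k, n)) (Z : 'M_(n, k)) :
  nzd s -> s%:M = U *m Z -> (k <= n)%N.
Proof.
move=> ns sUZ; rewrite leqNgt; apply/negP => nk.
pose f : 'I_n.+1 -> 'I_k := widen_ord nk.
have : \det (mxsub f f (s%:M : 'M_k)) = s ^+ n.+1.
  rewrite -det_scalar; congr (\det _); apply/matrixP => i j.
  by rewrite !mxE.
rewrite sUZ mxsub_mul det_mulmx_thin => /esym sn.
have /eqP := nzdX (n := n.+1) ns (a := 1) (etrans (mulr1 _) sn).
by rewrite oner_eq0.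
Qed.

(** The minors of size [n.+1] already vanish in [R], so the bound also holds at primes containing
    [s]. *)
Lemma rank_le_factor p n q k (s : R) (A : 'M_(q, k)) (U : 'M_(q, n))
    (X : 'M_(n, k)) (K : fieldType) (phi : {rmorphism R -> K}) :
  prime_id p -> residue p phi -> nzd s -> s *: A = U *m X ->
  (\rank (map_mx phi A) <= n)%N.
Proof.
move=> [[p0 _ _] _ _] phiP ns sA; rewrite leqNgt; apply/negP.
move=> /(rank_geP _ _ phiP)[f [g]]; apply.
suff -> : \det (mxsub f g A) = 0 by [].
apply: (nzdX (n := n.+1) ns); rewrite -detZ.
have -> : s *: mxsub f g A = mxsub f g (s *: A) by apply/matrixP => i j; rewrite !mxE.
by rewrite sA mxsub_mul det_mulmx_thin.
Qed.

Lemma basis_size k n (s : R) (U : 'M_(k, n)) (Z : 'M_(n, k)) :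
  nzd s -> s%:M = U *m Z -> (forall y : 'rV_n, y *m Z = 0 -> y = 0) -> k = n.
Proof.
move=> ns sUZ Zinj; apply/eqP; rewrite eqn_leq (scalar_factor_le ns sUZ) /=.
apply: (scalar_factor_le ns (U := Z) (Z := U)).
apply/eqP; rewrite -subr_eq0; apply/eqP/row_matrixP => i; rewrite row0.
apply: Zinj; rewrite -row_mul mulmxBl -mulmxA -sUZ mul_scalar_mx mul_mx_scalar.
by rewrite subrr row0.
Qed.

End Ranks.

Section ProjectiveResolution.
Variable R : comNzRingType.
Implicit Types (p N : R -> Prop).

(* Finitely generated projective modules are images of idempotents E j, and
   the maps between them are matrices A j. *)
Variables (m n : nat) (k : nat -> nat) (E : forall j, 'M[R]_(k j)).
Variables (A : forall j, 'M[R]_(k j.+1, k j)).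
Hypothesis EE : forall j, (m < j <= n)%N -> E j *m E j = E j.
Hypothesis AE : forall j, (m < j <= n)%N -> A j *m E j = A j.
Hypothesis EA : forall j, (m <= j < n)%N -> E j.+1 *m A j = A j.
Hypothesis AA : forall j, (m <= j < n)%N -> A j.+1 *m A j = 0.
Hypothesis exA : forall j, (m <= j < n)%N ->
  exact_mod (fun x => x = 0) (E j.+1) (A j.+1) (A j).
Hypothesis An : A n = 0.

(** The resolution is spliced with the right resolution beginning with [B]; exactness of [A m], [B]
    itself accounts for the extra 1 in [t.+1]. *)
Lemma projective_exact_mod t l (B : 'M[R]_(k m, l)) (J : R -> Prop) i N j :
  row_exact (A m) B -> torsionless t B -> reg_seq J i N -> (i <= t.+1)%N ->
  (m <= j < n)%N -> exact_mod N (E j.+1) (A j.+1) (A j).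
Proof.
move=> rAB tB rN; elim: rN j => [|h N' b rN' IH _ bN] j; first by move=> _; apply: exA.
rewrite ltnS => ht /andP[mj jn]; have iN := reg_ideal rN'.
have exj := IH j (leqW ht) (introT andP (conj mj jn)).
move: mj; rewrite leq_eqVlt => /orP[/eqP mj|mj].
  move: exj; rewrite -{}mj => exj.
  apply: (exact_mod_shift iN bN (mulmx1 _) (row_exact_comp rAB) exj).
  exact: torsionless_exact_mod rN' ht rAB tB.
case: j mj jn exj => // j mj jn exj.
apply: (exact_mod_shift iN bN _ _ exj (IH j (leqW ht) _)).
- by apply: AE; lia.
- by apply: AA; lia.
- by lia.
Qed.

(** Splittings descend from the trivially split [A n = 0]; this is where finiteness of the
    resolution enters. *)
Lemma projective_split t l (B : 'M[R]_(k m, l)) p j :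
  row_exact (A m) B -> torsionless t B -> assoc_prime t.+1 p ->
  (m <= j <= n)%N -> split_at p (A j).
Proof.
move=> rAB tB [pP [i [N [u [it rN nu pE]]]]].
have [K [phi phiP]] := residue_field pP.
suff h d j' : (n = d + j')%N -> (m <= j')%N -> split_at p (A j').
  by move=> /andP[mj jn]; apply: (h (n - j)%N) => //; rewrite subnK.
elim: d j' => [|d IHd] j' nE mj.
  rewrite -[j']add0n -{}nE An; exists 1, 0; split; first by case: pP.
  by rewrite !mul0mx scaler0.
have mjn : (m <= j' < n)%N by lia.
have mjn' : (m < j'.+1 <= n)%N by lia.
apply: (split_at_exact (reg_ideal rN) pE pP phiP (EE mjn') (AE mjn') (EA mjn')
  (AA mjn') (projective_exact_mod rAB tB rN it mjn) (IHd j'.+1 _ _)).1.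
  by lia.
by lia.
Qed.

End ProjectiveResolution.

(** * Change of presentation and counting of ranks *)

Section Presentations.
Variable R : comNzRingType.
Hypothesis noethR : noetherian R.

Lemma lift_rows (M : lmodType R) k l (P : {linear 'rV[R]_l -> M}) (y : 'I_k -> M) :
  (forall x, exists w, P w = x) ->
  exists L : 'M[R]_(k, l), forall v : 'rV_k, P (v *m L) = \sum_i v 0 i *: y i.
Proof.
move=> Psurj; have [w wP] := choice (fun i => Psurj (y i)).
exists (\matrix_i w i) => v; rewrite mulmx_sum_row linear_sum /=.
by apply: eq_bigr => i _; rewrite linearZ /= rowK wP.
Qed.

Lemma linear_row_sum (M : lmodType R) k (G : {linear 'rV[R]_k -> M}) v :
  G v = \sum_i v 0 i *: G (delta_mx 0 i).
Proof.
by rewrite {1}[v]row_sum_delta linear_sum; apply: eq_bigr => i _; rewrite linearZ.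
Qed.

(** The torsionless hypothesis comes with its own presentation. The comparison maps [L] and [L'] are
    mutually inverse modulo the relations, which suffices to transfer both exactness conditions. *)
Lemma torsionless_presentation t (M : lmodType R) k1 k2 q1 q2
    (P : {linear 'rV[R]_k1 -> M}) (G : {linear 'rV[R]_k2 -> M})
    (D : 'M_(q1, k1)) (A : 'M_(q2, k2)) :
  (forall x, exists w, P w = x) -> (forall x, exists w, G w = x) ->
  (forall v, P v = 0 <-> exists y, v = y *m D) ->
  (forall v, G v = 0 <-> exists y, v = y *m A) ->
  torsionless t D -> torsionless t A.
Proof.
case: t => // t Psurj Gsurj kerP kerG [l [B [rDB cDB tB]]].
have [L LP] : exists L : 'M[R]_(k2, k1), forall v, P (v *m L) = G v.
  have [L LP] := lift_rows (fun i => G (delta_mx 0 i)) Psurj.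
  by exists L => v; rewrite LP -linear_row_sum.
have [L' L'P] : exists L : 'M[R]_(k1, k2), forall v, G (v *m L) = P v.
  have [L' L'P] := lift_rows (fun i => P (delta_mx 0 i)) Gsurj.
  by exists L' => v; rewrite L'P -linear_row_sum.
have DB := row_exact_comp rDB.
have [X XP] : exists X, D *m L' = X *m A.
  apply: rows_factor => v; apply/kerG; rewrite mulmxA L'P; apply/kerP.
  by exists v.
have [Y YP] : exists Y, A *m L = Y *m D.
  apply: rows_factor => v; apply/kerP; rewrite mulmxA LP; apply/kerG.
  by exists v.
have [Z ZP] : exists Z, L *m L' - 1%:M = Z *m A.
  apply: rows_factor => v; apply/kerG.
  by rewrite mulmxBr mulmx1 linearB mulmxA /= L'P LP subrr.
have LB : B = L' *m (L *m B).
  apply/eqP; rewrite -subr_eq0 mulmxA -{1}[B]mul1mx -mulmxBl; apply/eqP.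
  have [W ->] : exists W, 1%:M - L' *m L = W *m D.
    apply: rows_factor => v; apply/kerP.
    by rewrite mulmxBr mulmx1 linearB mulmxA /= LP L'P subrr.
  by rewrite -mulmxA DB mulmx0.
exists l, (L *m B); split.
- move=> v; rewrite mulmxA -kerG -LP kerP; exact: rDB.
- move=> w; split=> [Aw|[z ->]]; last first.
    by rewrite !mulmxA YP -(mulmxA Y) DB mulmx0 mul0mx.
  have /cDB[z zE] : D *m (L' *m w) = 0 by rewrite mulmxA XP -mulmxA Aw mulmx0.
  exists z; rewrite -mulmxA -zE; apply/eqP; rewrite eq_sym -subr_eq0.
  by rewrite mulmxA -{2}[w]mul1mx -mulmxBl ZP -mulmxA Aw mulmx0.
- by apply: torsionless_eqrow tB; [exists L' | exists L].
Qed.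

End Presentations.

Section RankCount.
Variable R : comNzRingType.

Lemma has_rank_in_linear (V W : lmodType R) (h : {linear V -> W}) (P : V -> Prop)
    (Q : W -> Prop) r :
  (forall v, h v = 0 -> v = 0) -> (forall w, Q w <-> exists2 v, P v & w = h v) ->
  has_rank_in P r -> has_rank_in Q r.
Proof.
move=> hinj QP [x [Px xs xi]].
have hsum (a : 'I_r -> R) : \sum_i a i *: h (x i) = h (\sum_i a i *: x i).
  by rewrite linear_sum; apply: eq_bigr => i _; rewrite linearZ.
exists (fun i => h (x i)); split.
- by move=> i; apply/QP; exists (x i).
- move=> _ /QP[v /xs[s [ns [a sv]]] ->]; exists s; split=> //; exists a.
  by rewrite hsum -sv linearZ.
- move=> a [t [nt]]; rewrite hsum -linearZ /= => /hinj ta0.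
  by apply: xi; exists t.
Qed.

(** The two factorizations carry the generic ranks to arbitrary primes via [rank_le_factor]: the
    first bounds the rank of [A] by [r], the second that of any [B] with [A *m B = 0] by [s]. *)
Lemma rank_count (M : lmodType R) k q (G : {linear 'rV[R]_k -> M}) (A : 'M_(q, k))
    r s :
  (forall x, exists w, G w = x) -> (forall v, G v = 0 <-> exists y, v = y *m A) ->
  has_rank_in (fun v : 'rV_k => exists y, v = y *m A) r -> has_rank M s ->
  [/\ k = (r + s)%N,
      exists a (U : 'M_(q, r)) X, nzd a /\ a *: A = U *m X
    & exists a (U : 'M_(k, s)) Y V, nzd a /\ a%:M = U *m Y + V *m A].
Proof.
move=> Gsurj kerG [x [xA xs xi]] [y [_ ys yi]].
pose X := \matrix_i x i.
have Xsum (a : 'rV_r) : a *m X = \sum_i a 0 i *: x i.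
  by rewrite mulmx_sum_row; apply: eq_bigr => i _; rewrite rowK.
have [Y YP] := lift_rows y Gsurj.
have [a na [U aU]] : exists2 a, nzd a & exists U, a *: A = U *m X.
  apply: common_denominator => i; have [|a [na [c cP]]] := xs (row i A).
    by exists (delta_mx 0 i); rewrite rowE.
  exists a => //; exists (\row_j c j); rewrite Xsum cP.
  by apply: eq_bigr => j _; rewrite mxE.
have [b nb [V bV]] : exists2 b, nzd b & exists V, b *: 1%:M = V *m col_mx Y A.
  apply: common_denominator => i; have [//|b [nb [c cP]]] := ys (G (row i 1%:M)).
  have /kerG[w wP] : G (b *: row i 1%:M - \row_j c j *m Y) = 0.
    rewrite linearB linearZ /= cP YP; apply/eqP; rewrite subr_eq0; apply/eqP.
    by apply: eq_bigr => j _; rewrite mxE.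
  exists b => //; exists (row_mx (\row_j c j) w).
  by rewrite mul_row_col -wP addrC subrK.
have bE : b%:M = lsubmx V *m Y + rsubmx V *m A.
  by rewrite -mul_row_col hsubmxK -bV scalemx1.
split; last 2 first.
- by exists a, U, X.
- by exists b, (lsubmx V), Y, (rsubmx V).
have XA : exists Z, X = Z *m A.
  have [z zP] := choice xA; exists (\matrix_i z i).
  by apply/row_matrixP => i; rewrite row_mul !rowK.
apply: (@basis_size _ _ _ (a * b) (row_mx (rsubmx V *m U) (a *: lsubmx V))
  (col_mx X Y)).
- exact: nzdM.
- rewrite mul_row_col -mulmxA -aU -scale_scalar_mx bE scalerDr addrC.
  by rewrite -scalemxAr -scalemxAl.
move=> z; rewrite -[z]hsubmxK mul_row_col; set z1 := lsubmx z; set z2 := rsubmx z.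
move=> zXY.
have z20 : z2 = 0.
  apply/rowP => i; rewrite [RHS]mxE; apply: (yi (fun i => z2 0 i) _ i); exists 1.
  split; first exact: nzd1.
  rewrite scale1r -YP; have -> : z2 *m Y = - (z1 *m X).
    by apply/eqP; rewrite -addr_eq0 addrC zXY.
  have [Z ->] := XA; rewrite -mulNmx mulmxA; apply/kerG.
  by exists (- z1 *m Z).
move: zXY; rewrite z20 mul0mx addr0 => zX; suff -> : z1 = 0 by rewrite row_mx0.
apply/rowP => i; rewrite [RHS]mxE; apply: (xi (fun i => z1 0 i) _ i); exists 1.
by split; [exact: nzd1 | rewrite scale1r -Xsum].
Qed.

Lemma projective_data (m n : nat) (F : nat -> lmodType R) :
  (forall j, (m <= j <= n)%N -> fg_projective (F j)) -> fg_free (F m) ->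
  exists (k : nat -> nat) (i : forall j, {linear F j -> 'rV[R]_(k j)})
    (p : forall j, {linear 'rV[R]_(k j) -> F j}),
    (forall j, (m <= j <= n)%N -> cancel (i j) (p j)) /\ cancel (p m) (i m).
Proof.
move=> projF freeF.
have h j : exists d : {k : nat &
      ({linear F j -> 'rV[R]_k} * {linear 'rV[R]_k -> F j})%type},
    ((m <= j <= n)%N -> cancel (tagged d).1 (tagged d).2) /\
    (j = m -> cancel (tagged d).2 (tagged d).1).
  case: (pselect (j = m)) => [->|jm].
    have [k [i [p [ip pi]]]] := freeF.
    by exists (existT _ k (i, p)).
  case: (boolP (m <= j <= n)%N) => [/projF[k [i [p ip]]]|_].
    by exists (existT _ k (i, p)).
  pose z1 : {linear F j -> 'rV[R]_0} := \0; pose z2 : {linear 'rV[R]_0 -> F j} := \0.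
  by exists (existT _ 0%N (z1, z2)).
exists (fun j => tag (sval (cid (h j)))), (fun j => (tagged (sval (cid (h j)))).1),
  (fun j => (tagged (sval (cid (h j)))).2).
by split=> [j|]; [apply: (svalP (cid (h j))).1 | apply: (svalP (cid (h m))).2].
Qed.

End RankCount.

(* Indexing: F j is the paper's F_j (only m <= j <= n matter), and
   f j : F j.+1 -> F j is the paper's f_(j+1).  fs j : R^(2j+1) -> R^(2j-1)
   is the paper's f_j (1 <= j <= m-1); fm is the paper's f_m, whose codomain
   R^((m-1)*2+1) is R^(2m-1) since m >= 1. *)
Theorem theorem3 (R : comNzRingType) (m n : nat)
  (F : nat -> lmodType R) (f : forall j : nat, {linear F j.+1 -> F j})
  (M : lmodType R) (g : {linear F m -> M}) (r : nat) :
  noetherian R ->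
  (1 <= m)%N -> (m < n)%N ->
  fg_module M -> m_torsionless M m -> (exists rM, has_rank M rM) ->
  (forall j, (m <= j <= n)%N -> fg_projective (F j)) ->
  fg_free (F m) ->
  (* exactness of 0 -> F_n -> ... -> F_m -> M -> 0 *)
  (forall j, j.+1 = n -> forall x : F j.+1, f j x = 0 -> x = 0) ->
  (forall j, (m <= j)%N -> (j.+2 <= n)%N -> exact_at (f j.+1) (f j)) ->
  exact_at (f m) g ->
  (forall y : M, exists x, g x = y) ->
  (* r = rank of Im f_(m+1) *)
  has_rank_in (fun y : F m => exists x, y = f m x) r ->
  exists (c : {linear F m -> 'rV[R]_(r + m)})
         (fm : 'M[R]_(r + m, (m.-1).*2.+1))
         (fs : forall j : nat, 'M[R]_(j.*2.+1, j.*2.-1)),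
    (* exactness at F_n, ..., F_(m+2) (maps unchanged) *)
        (forall j, j.+1 = n -> (m.+1 <= j)%N -> forall x : F j.+1, f j x = 0 -> x = 0) /\
        (forall j, (m.+1 <= j)%N -> (j.+2 <= n)%N -> exact_at (f j.+1) (f j)) /\
        (* exactness at F_(m+1), with f'_(m+1) = c \o f_(m+1) *)
        ((m.+1 = n) -> forall x : F m.+1, c (f m x) = 0 -> x = 0) /\
        ((m.+2 <= n)%N -> exact_at (f m.+1) (fun x => c (f m x))) /\
        (* exactness at R^(r+m) *)
        exact_at (fun x => c (f m x)) (fun v : 'rV[R]_(r + m) => v *m fm) /\
        (* exactness at R^(2m-1) (if m >= 2) *)
        ((2 <= m)%N -> exact_at (fun v : 'rV[R]_(r + m) => v *m fm)
                               (fun w : 'rV[R]_((m.-1).*2.+1) => w *m fs m.-1)) /\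
        (* exactness at R^(2j+1), 1 <= j <= m-2 *)
        (forall j, (1 <= j)%N -> (j.+2 <= m)%N ->
           exact_at (fun v : 'rV[R]_(j.+1.*2.+1) => v *m fs j.+1)
                    (fun w : 'rV[R]_(j.*2.+1) => w *m fs j)).
Proof.
move=> noethR m1 mn _ tM [rM rkM] projF freeF finj fex gex gsurj rkK.
have [k [i [p [ip pm]]]] := projective_data projF freeF.
(* Setting the maps to 0 from index [n] on turns injectivity at the left end into exactness, so all
   places are treated alike. *)
pose f' j : {linear F j.+1 -> F j} := if (j < n)%N then f j else \0.
have f'E j : (j < n)%N -> f' j = f j by rewrite /f' => ->.
have f'0 j : (n <= j)%N -> f' j = \0 by rewrite /f' leqNgt => /negPf->.
have f'ex j : (m <= j < n)%N -> exact_at (f' j.+1) (f' j).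
  move=> /andP[mj jn]; rewrite (f'E j jn); case: (ltnP j.+1 n) => jn'.
    by rewrite f'E //; apply: fex.
  rewrite f'0 //; have jE : j.+1 = n by apply/eqP; rewrite eqn_leq jn jn'.
  by move=> x; split=> [/(finj _ jE)->|[z ->]]; [exists 0 | exact: linear0].
pose A j : 'M_(k j.+1, k j) := lin1_mx (i j \o f' j \o p j.+1).
have AP j v : v *m A j = i j (f' j (p j.+1 v)) by rewrite mul_rV_lin1.
pose E j : 'M_(k j) := lin1_mx (i j \o p j).
have EP j v : v *m E j = i j (p j v) by rewrite mul_rV_lin1.
have iinj j v : (m <= j <= n)%N -> i j v = 0 -> v = 0.
  by move=> mjn iv; rewrite -(ip j mjn v) iv linear0.
have rowext a b (U V : 'M[R]_(a, b)) : (forall v : 'rV_a, v *m U = v *m V) -> U = V.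
  by move=> h; apply/row_matrixP => e; rewrite !rowE.
have mm : (m <= m <= n)%N by rewrite leqnn ltnW.
have EE j : (m < j <= n)%N -> E j *m E j = E j.
  by move=> mjn; apply: rowext => v; rewrite mulmxA !EP ip //; lia.
have AE j : (m < j <= n)%N -> A j *m E j = A j.
  by move=> mjn; apply: rowext => v; rewrite mulmxA EP !AP ip //; lia.
have EA j : (m <= j < n)%N -> E j.+1 *m A j = A j.
  by move=> mjn; apply: rowext => v; rewrite mulmxA !AP EP ip //; lia.
have AA j : (m <= j < n)%N -> A j.+1 *m A j = 0.
  move=> mjn; apply: rowext => v; rewrite mulmx0 mulmxA !AP ip; last by lia.
  set z := p _ v; suff -> : f' j (f' j.+1 z) = 0 by rewrite linear0.
  by apply/(f'ex j mjn); exists z.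
have exA j : (m <= j < n)%N ->
    exact_mod (fun x => x = 0) (E j.+1) (A j.+1) (A j).
  move=> mjn; apply/exact_mod0 => v; rewrite AP => /iinj h.
  have /(f'ex j mjn)[z zE] : f' j (p j.+1 v) = 0 by apply: h; lia.
  rewrite EP zE; case: (ltnP j.+1 n) => jn; last first.
    by exists 0; rewrite mul0mx f'0 // linear0.
  by exists (i j.+2 z); rewrite AP ip //; lia.
have An : A n = 0.
  by apply: rowext => v; rewrite mulmx0 AP f'0 // linear0.
pose G : {linear 'rV[R]_(k m) -> M} := g \o p m.
have Gsurj x : exists w, G w = x.
  by have [y <-] := gsurj x; exists (i m y); rewrite /= ip.
have fA z : i m (f m z) = i m.+1 z *m A m by rewrite AP ip ?f'E //; lia.
have kerG v : G v = 0 <-> exists y, v = y *m A m.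
  split=> [/gex[z zE]|[y ->]].
    by exists (i m.+1 z); rewrite -fA -zE pm.
  rewrite AP /= ip // f'E //; apply/gex.
  by exists (p m.+1 y).
have rkA : has_rank_in (fun v : 'rV_(k m) => exists y, v = y *m A m) r.
  apply: (has_rank_in_linear (h := i m)) rkK; first by move=> v; apply: iinj.
  move=> w; split=> [[y ->]|[_ [z ->] ->]]; last by exists (i m.+1 z).
  by exists (f m (p m.+1 y)); [exists (p m.+1 y) | rewrite AP f'E].
have [kE [a [U [X [na aA]]]] [b [U' [Y [V [nb bA]]]]]] := rank_count Gsurj kerG rkA rkM.
have tA : torsionless m (A m).
  have [s [d [P [Psurj kerP rd cd]]]] := tM.
  have := torsionless_seq (t := m) rd cd.
  exact: torsionless_presentation Psurj Gsurj kerP kerG.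
have [l [B [rAB cAB tB]]] := torsionlessP m1 tA.
have gA : good_pres m r (A m).
  split=> // q mq; have pq := mq.1.
  have sA : split_at q (A m).
    have mE : m = m.-1.+1 by rewrite prednK.
    move: mq; rewrite [in assoc_prime m]mE => mq.
    exact: (projective_split EE AE EA AA exA An rAB tB mq mm).
  split=> // K phi phiP; apply/eqP; rewrite eqn_leq.
  rewrite (rank_le_factor pq phiP na aA) /=.
  have bB : b *: B = U' *m (Y *m B).
    rewrite -mul_scalar_mx bA mulmxDl -(mulmxA V) (row_exact_comp rAB) mulmx0.
    by rewrite addr0 mulmxA.
  have rB := rank_le_factor pq phiP nb bB.
  rewrite -(leq_add2r rM) -kE; apply: leq_trans (split_at_rank phiP cAB sA) _.
  by rewrite addnC leq_add2l.
have [C [Cinj gAC]] := good_pres_reduce noethR (erefl (r + m)%N) gA.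
have [fm [fmE gfm]] := good_pres_next noethR m1 erefl gAC.
have [|fs [fsm fsP]] := three_generated_tail noethR (m := m.-1) (B := fm).
  by rewrite prednK.
pose c : {linear F m -> 'rV[R]_(r + m)} := mulmxr C \o i m.
have cE x : c (f m x) = i m.+1 x *m (A m *m C) by rewrite mulmxA -fA.
have cinj x : c (f m x) = 0 -> f m x = 0.
  rewrite cE mulmxA => /Cinj; rewrite -fA => /iinj; exact.
exists c, fm, fs; split; first by move=> j jn _; apply: finj.
split; first by move=> j mj; apply: fex; apply: ltnW.
split; first by move=> mn1 x /cinj; apply: finj.
split=> [mn2 x|].
  rewrite -(fex m (leqnn m) mn2 x); split=> [/cinj//|fx].
  by rewrite fx linear0.
split=> [v|].
  rewrite (fmE v); split=> [[y ->]|[x ->]]; last by exists (i m.+1 x); rewrite cE.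
  by exists (p m.+1 y); rewrite /= mulmxA AP f'E.
split=> [m2|j j1 jm]; first by apply: fsm; lia.
by apply: fsP; lia.
Qed.
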